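(* For all positive integers $k,l\ge 1$, in the split Grothendieck ring $K_0(\operatorname{Kar}(\mathbf{Sp}_q))$ of the Karoubi envelope of the $A_2$ spider, $$\langle P_{(k+1,l)}\rangle=X\langle P_{(k,l)}\rangle-\langle P_{(k-1,l+1)}\rangle-\langle P_{(k,l-1)}\rangle,$$ where $P_{(k,l)}=({+}^k{-}^l,\,P_{{+}^k{-}^l}^{{+}^k{-}^l})$ and $X=\langle({+},\mathbf 1_{+})\rangle$.
   Context: **The $A_2$ spider.** Let $[n]=(q^{n/2}-q^{-n/2})/(q^{1/2}-q^{-1/2})$ and ${n\brack i}=\frac{[n]!}{[i]!\,[n-i]!}$. $\mathbf{Sp}_q$ is the following $\mathbb C(q^{1/6})$-linear monoidal category. Objects are finite (possibly empty) sequences of signs $+,-$; tensor product of objects is concatenation; ${+}^k$, ${-}^k$ are constant sequences of length $k$. A web from $\epsilon$ (length $m$) to $\delta$ (length $n$) is a directed planar graph in $[0,1]\times[0,1]$, up to boundary-fixing isotopy, with $m$ univalent vertices on the bottom side, $n$ univalent vertices on the top side, and all other vertices interior, trivalent, and either sinks or sources (vertexless closed loops are allowed in webs). The edge at the $i$-th bottom point is directed away from that point if $\epsilon(i)=+$ and toward it if $\epsilon(i)=-$; the edge at the $j$-th top point is directed toward that point if $\delta(j)=+$ and away from it if $\delta(j)=-$. A basis web is a web without closed loops in which every internal face (one not meeting the boundary of the square) has at least six sides. $\mathbf{Sp}_q(\epsilon,\delta)$ is the vector space with basis the basis webs from $\epsilon$ to $\delta$. Composition $GF$ stacks $G$ on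 top of $F$ and reduces to basis webs by the local relations: a closed loop (either orientation) equals $[3]$ times its removal; an internal $2$-gon equals $[2]$ times a single edge; an internal $4$-gon equals the sum of the two webs obtained by replacing it with two disjoint arcs joining its four external legs in the two planar, orientation-compatible ways. The identity $\mathbf 1_\epsilon$ is given by vertical parallel edges; tensor product of webs is horizontal juxtaposition. **Elementary webs.** $t_{++}^{-}\colon{+}{+}\to{-}$ and $t_{-}^{++}\colon{-}\to{+}{+}$ are the webs with exactly one trivalent vertex. $b^{(i)}\colon\emptyset\to{+}^i{-}^i$ and $d^{(i)}\colon{+}^i{-}^i\to\emptyset$ are $i$ nested cups, resp. caps. **Clasps.** $P_{{+}^0}^{{+}^0}$ is the empty web, $P_{+}^{+}=\mathbf 1_+$, and $$P_{{+}^k}^{{+}^k}=P_{{+}^{k-1}}^{{+}^{k-1}}\otimes\mathbf 1_+-\tfrac{[k-1]}{[k]}\,(P_{{+}^{k-1}}^{{+}^{k-1}}\otimes\mathbf 1_+)(\mathbf 1_{{+}^{k-2}}\otimes t_{-}^{++}t_{++}^{-})(P_{{+}^{k-1}}^{{+}^{k-1}}\otimes\mathbf 1_+).$$ $P_{{-}^k}^{{-}^k}$ is obtained by reversing all edge directions. For $k,l\ge0$, $$P_{{+}^k{-}^l}^{{+}^k{-}^l}=\sum_{i=0}^{\min\{k,l\}}(-1)^i\frac{{k\brack i}{l\brack i}}{{k+l+1\brack i}}\,(P_{{+}^k}^{{+}^k}\otimes P_{{-}^l}^{{-}^l})(\mathbf 1_{{+}^{k-i}}\otimes b^{(i)}d^{(i)}\otimes\mathbf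 1_{{-}^{l-i}})(P_{{+}^k}^{{+}^k}\otimes P_{{-}^l}^{{-}^l}).$$ These are idempotents. **Karoubi envelope and $K_0$.** Objects of $\operatorname{Kar}(\mathcal A)$ are pairs $(Z,f)$ with $f\in\operatorname{End}(Z)$ idempotent; morphisms $(Z,f)\to(W,g)$ are morphisms $\phi\colon Z\to W$ of $\mathcal A$ with $g\phi f=\phi$; $(Z,f)\otimes(W,g)=(Z\otimes W,f\otimes g)$. Finite (formal) direct sums are adjoined so that $\operatorname{Kar}(\mathbf{Sp}_q)$ is additive. $K_0$ of an additive monoidal category is the ring generated by isomorphism classes $\langle Z\rangle$ modulo $\langle Z_1\oplus Z_2\rangle=\langle Z_1\rangle+\langle Z_2\rangle$, with product $\langle Z\otimes W\rangle=\langle Z\rangle\langle W\rangle$ and unit $1$ the class of the empty sequence with the empty web. *)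

(* Defs.v *)
From HB Require Import structures.
From mathcomp Require Import all_boot all_order all_algebra.
From mathcomp Require Import generic_quotient fraction complex finmap monalg.
From mathcomp Require Import boolp reals.

Set Implicit Arguments.
Unset Strict Implicit.
Unset Printing Implicit Defensive.

Import GRing.Theory.
Local Open Scope ring_scope.
Local Open Scope quotient_scope.

(* Webs.  A planar web in the square, in general position with respect to the
   height function, is cut by horizontal lines into slices, each of which
   contains one cup, one cap or one trivalent vertex, and otherwise vertical
   strands.  After an isotopy the three legs of every vertex point upwards.   *)

(* [true] is the sign +, [false] the sign -. *)
Notation sign := bool.

(* [Cup s] : 0 -> s (-s);  [Cap s] : s (-s) -> 0;  [Vertex s] : 0 -> s s s,
   which is a source for s = + and a sink for s = -.                          *)
Inductive elem := Cup of sign | Cap of sign | Vertex of sign.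

Definition elem_code (g : elem) : sign + sign + sign :=
  match g with
  | Cup s => inl (inl s) | Cap s => inl (inr s) | Vertex s => inr s
  end.
Definition elem_decode (c : sign + sign + sign) : elem :=
  match c with
  | inl (inl s) => Cup s | inl (inr s) => Cap s | inr s => Vertex s
  end.
Lemma elem_codeK : cancel elem_code elem_decode. Proof. by case. Qed.
HB.instance Definition _ := Countable.copy elem (can_type elem_codeK).

Definition elem_bot (g : elem) : seq sign :=
  if g is Cap s then [:: s; ~~ s] else [::].
Definition elem_top (g : elem) : seq sign :=
  match g with
  | Cup s => [:: s; ~~ s] | Cap _ => [::] | Vertex s => [:: s; s; s]
  end.

(* [(l, g, r)] is [g] with vertical strands [l] on its left and [r] on its
   right.  Lists of slices are read from the bottom to the top.               *)
Definition slice : Type := seq sign * elem * seq sign.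

Fixpoint is_diagram (eps : seq sign) (w : seq slice) (del : seq sign) : bool :=
  if w is (l, g, r) :: w' then
    (eps == l ++ elem_bot g ++ r) && is_diagram (l ++ elem_top g ++ r) w' del
  else eps == del.

Record diagram (eps del : seq sign) := Diagram {
  slices :> seq slice;
  diagramP : is_diagram eps slices del }.
HB.instance Definition _ eps del := [isSub for @slices eps del].
HB.instance Definition _ eps del := [Choice of diagram eps del by <:].

Definition whisker (l r : seq sign) (w : seq slice) : seq slice :=
  [seq (l ++ x.1.1, x.1.2, x.2 ++ r) | x <- w].

Lemma is_diagram_cat eps w del w' gam :
  is_diagram eps w del -> is_diagram del w' gam -> is_diagram eps (w ++ w') gam.
Proof.
elim: w eps => [|[[l g] r] w IHw] eps /=; first by move/eqP->.
by case/andP=> -> /IHw h /h.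
Qed.

Lemma is_diagram_whisker l r eps w del :
  is_diagram eps w del ->
  is_diagram (l ++ eps ++ r) (whisker l r w) (l ++ del ++ r).
Proof.
elim: w eps => [|[[l' g] r'] w IHw] eps /=; first by move/eqP->.
by case/andP=> /eqP-> /IHw; rewrite -!catA eqxx.
Qed.

Definition id_diagram eps : diagram eps eps :=
  @Diagram eps eps [::] (eqxx eps).

Definition stack eps del gam (D' : diagram del gam) (D : diagram eps del) :
  diagram eps gam := Diagram (is_diagram_cat (diagramP D) (diagramP D')).

Lemma juxtapose_subproof eps del eps' del'
  (D : diagram eps del) (D' : diagram eps' del') :
  is_diagram (eps ++ eps') (whisker [::] eps' D ++ whisker del [::] D')
    (del ++ del').
Proof.
apply: (@is_diagram_cat _ _ (del ++ eps')).
  exact: (is_diagram_whisker [::] _ (diagramP D)).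
by have := is_diagram_whisker del [::] (diagramP D'); rewrite !cats0.
Qed.
Definition juxtapose eps del eps' del'
    (D : diagram eps del) (D' : diagram eps' del') :
  diagram (eps ++ eps') (del ++ del') := Diagram (juxtapose_subproof D D').

(* Planar isotopy: distant pieces pass each other, bent strands straighten, and
   a vertex can be rotated.                                                   *)
Inductive isotopy_move : seq slice -> seq slice -> Prop :=
| IsoExchange g m g' : isotopy_move
    [:: ([::], g, m ++ elem_bot g'); (elem_top g ++ m, g', [::])]
    [:: (elem_bot g ++ m, g', [::]); ([::], g, m ++ elem_top g')]
| IsoZigzagL s : isotopy_move
    [:: ([::], Cup s, [:: s]); ([:: s], Cap (~~ s), [::])] [::]
| IsoZigzagR s : isotopy_move
    [:: ([:: s], Cup (~~ s), [::]); ([::], Cap s, [:: s])] [::]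
| IsoRotate s : isotopy_move
    [:: ([::], Cup (~~ s), [::]);
        ([:: ~~ s], Vertex s, [:: s]);
        ([::], Cap (~~ s), [:: s; s; s])]
    [:: ([::], Vertex s, [::])].

(* A disc inside a web, given by what lies below it, on its left, on its right
   and above it.                                                              *)
Record place := Place {
  p_below : seq slice; p_left : seq sign; p_right : seq sign;
  p_above : seq slice }.
Definition plug (p : place) (w : seq slice) : seq slice :=
  p_below p ++ whisker (p_left p) (p_right p) w ++ p_above p.

Inductive isotopic eps del : diagram eps del -> diagram eps del -> Prop :=
| isotopic_move p w w' (D D' : diagram eps del) :
    isotopy_move w w' -> D = plug p w :> seq slice ->
    D' = plug p w' :> seq slice -> isotopic D D'
| isotopic_refl D : isotopic D D
| isotopic_sym D D' : isotopic D D' -> isotopic D' D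
| isotopic_trans D D' D'' :
    isotopic D D' -> isotopic D' D'' -> isotopic D D''.

(* The trivalent vertices (-s) -> s s and s s -> (-s); for s = + these are the
   webs t_-^{++} and t_{++}^-.                                                *)
Definition split_slices s : seq slice :=
  [:: ([::], Vertex s, [:: ~~ s]); ([:: s; s], Cap s, [::])].
Definition merge_slices s : seq slice :=
  [:: ([:: s; s], Vertex (~~ s), [::]);
      ([:: s], Cap s, [:: ~~ s; ~~ s]); ([::], Cap s, [:: ~~ s])].

(* A closed loop; the other orientation is [~~ s]. *)
Definition loop_slices s : seq slice :=
  [:: ([::], Cup s, [::]); ([::], Cap s, [::])].
Definition bigon_slices s : seq slice := split_slices s ++ merge_slices s.
(* s (-s) -> s s s -> (-s) s -> s s s -> s (-s).  Its inner face is a 4-gon,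
   and the two planar matchings of its legs compatible with the orientation are
   the identity and [capcup_slices s].                                        *)
Definition square_slices s : seq slice :=
  whisker [:: s] [::] (split_slices s) ++ whisker [::] [:: s] (merge_slices s)
  ++ whisker [::] [:: s] (split_slices s)
  ++ whisker [:: s] [::] (merge_slices s).
Definition capcup_slices s : seq slice :=
  [:: ([::], Cap s, [::]); ([::], Cup s, [::])].

Lemma split_subproof s : is_diagram [:: ~~ s] (split_slices s) [:: s; s].
Proof. by case: s. Qed.
Definition split_diagram s : diagram [:: ~~ s] [:: s; s] :=
  Diagram (split_subproof s).

Lemma merge_subproof s : is_diagram [:: s; s] (merge_slices s) [:: ~~ s].
Proof. by case: s. Qed.
Definition merge_diagram s : diagram [:: s; s] [:: ~~ s] :=
  Diagram (merge_subproof s).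

Definition cups_slices i : seq slice :=
  [seq (nseq j true, Cup true, nseq j false) | j <- iota 0 i].
Definition caps_slices i : seq slice :=
  rev [seq (nseq j true, Cap true, nseq j false) | j <- iota 0 i].

Lemma nseq_cups j : nseq j true ++ [:: true; false] ++ nseq j false =
                    nseq j.+1 true ++ nseq j.+1 false.
Proof.
have H t : nseq j true ++ true :: t = true :: nseq j true ++ t.
  by elim: j => //= j ->.
exact: H.
Qed.

Lemma cups_subproof i :
  is_diagram [::] (cups_slices i) (nseq i true ++ nseq i false).
Proof.
rewrite /cups_slices; elim: i => // i IHi.
rewrite -addn1 iotaD map_cat; apply: is_diagram_cat IHi _.
by rewrite /= add0n addn1 nseq_cups !eqxx.
Qed.
Definition cups i : diagram [::] (nseq i true ++ nseq i false) :=
  Diagram (cups_subproof i).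

Lemma caps_subproof i :
  is_diagram (nseq i true ++ nseq i false) (caps_slices i) [::].
Proof.
rewrite /caps_slices; elim: i => // i IHi.
rewrite -[in iota _ _]addn1 iotaD map_cat rev_cat.
apply: is_diagram_cat IHi.
by rewrite /= add0n nseq_cups !eqxx.
Qed.
Definition caps i : diagram (nseq i true ++ nseq i false) [::] :=
  Diagram (caps_subproof i).

Section FreeModule.
Variables (K : fieldType) (A : choiceType) (V : lmodType K).
Implicit Types (phi : A -> V) (x y : {malg K[A]}).

Definition extend phi x : V := \sum_(a <- msupp x) x@_a *: phi a.

Lemma extendEw phi x (d : {fset A}) : (msupp x `<=` d)%fset ->
  extend phi x = \sum_(a <- d) x@_a *: phi a.
Proof.
move=> le_xd; apply: big_fset_incl => // a _.
by move/mcoeff_outdom->; rewrite scale0r.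
Qed.

Lemma extendU phi a : extend phi << a >> = phi a.
Proof.
rewrite (extendEw _ msuppU_le) big_seq_fset1.
by rewrite mcoeffUU scale1r.
Qed.

Lemma extend_linear phi : linear (extend phi).
Proof.
move=> c x y; pose d := (msupp x `|` msupp y)%fset.
have lx : (msupp x `<=` d)%fset by exact: fsubsetUl.
have ly : (msupp y `<=` d)%fset by exact: fsubsetUr.
have lxy : (msupp (c *: x + y) `<=` d)%fset.
  apply: fsubset_trans (msuppD_le _ _) _; apply: fsetSU; exact: msuppZ_le.
rewrite !(extendEw _ lx, extendEw _ ly, extendEw _ lxy) scaler_sumr -big_split.
by apply: eq_bigr => a _; rewrite mcoeffD mcoeffZ scalerDl scalerA.
Qed.
HB.instance Definition _ phi :=
  GRing.isLinear.Build K {malg K[A]} V *:%R (extend phi) (extend_linear phi).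

Lemma eq_extend phi phi' : phi =1 phi' -> extend phi =1 extend phi'.
Proof. by move=> e x; apply: eq_bigr => a _; rewrite e. Qed.

Lemma extend_linearl c phi phi' x :
  extend (fun a => c *: phi a + phi' a) x = c *: extend phi x + extend phi' x.
Proof.
rewrite scaler_sumr -big_split; apply: eq_bigr => a _.
by rewrite scalerDr !scalerA mulrC.
Qed.

Lemma malg_ind (P : {malg K[A]} -> Prop) :
  P 0 -> (forall c a x, P x -> P (c *: << a >> + x)) -> forall x, P x.
Proof.
move=> P0 PD x; rewrite (monalgE x).
elim: (enum_fset _) => [|a s IHs]; rewrite ?big_nil // big_cons.
suff -> : << x@_a *g a >> = x@_a *: << a >> :> {malg K[A]} by exact: PD.
by apply/malgP => b; rewrite mcoeffZ !mcoeffU mulr_natr.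
Qed.
End FreeModule.

(* [qhalf] stands for q^{1/2}. *)
Section QuantumIntegers.
Variables (K : fieldType) (qhalf : K).

Definition qint (n : nat) : K :=
  (qhalf ^+ n - qhalf ^- n) / (qhalf - qhalf^-1).
Definition qfact (n : nat) : K := \prod_(i < n) qint i.+1.
Definition qbinom (n i : nat) : K := qfact n / (qfact i * qfact (n - i)).
End QuantumIntegers.

(* Sp(eps, del) is the vector space of webs modulo the local relations.  By
   Kuperberg's theorem the webs without closed loops, and without internal
   2-gons and 4-gons, form a basis of this quotient, so that the class of a web
   is its reduction to basis webs.                                            *)
Section Hom.
Variables (K : fieldType) (qhalf : K) (eps del : seq sign).
Local Notation comb := {malg K[diagram eps del]}.

Inductive null : comb -> Prop :=
| null_isotopy D D' : isotopic D D' -> null (<< D >> - << D' >>)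
| null_loop p s (D D0 : diagram eps del) :
    D = plug p (loop_slices s) :> seq slice ->
    D0 = plug p [::] :> seq slice ->
    null (<< D >> - qint qhalf 3 *: << D0 >>)
| null_bigon p s (D D0 : diagram eps del) :
    D = plug p (bigon_slices s) :> seq slice ->
    D0 = plug p [::] :> seq slice ->
    null (<< D >> - qint qhalf 2 *: << D0 >>)
| null_square p s (D D1 D2 : diagram eps del) :
    D = plug p (square_slices s) :> seq slice ->
    D1 = plug p [::] :> seq slice ->
    D2 = plug p (capcup_slices s) :> seq slice ->
    null (<< D >> - (<< D1 >> + << D2 >>))
| null0 : null 0
| nullD x y : null x -> null y -> null (x + y)
| nullZ c x : null x -> null (c *: x).

Lemma nullN x : null x -> null (- x).
Proof. by rewrite -scaleN1r; apply: nullZ. Qed.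

Definition null_eq : rel comb := fun x y => `[< null (x - y) >].

Lemma null_eq_equiv : equiv_class_of null_eq.
Proof.
split=> [x|x y|y x z].
- by apply/asboolP; rewrite subrr; apply: null0.
- by apply/asboolP/asboolP => /nullN; rewrite opprB.
- move=> /asboolP xy /asboolP yz; apply/asboolP.
  by rewrite -(subrK y x) -addrA; apply: nullD.
Qed.
Canonical null_equiv := EquivRelPack null_eq_equiv.
Canonical null_equiv_direct := defaultEncModRel null_eq.

Definition Sp := {eq_quot null_eq}.
HB.instance Definition _ := Choice.on Sp.
HB.instance Definition _ := EqQuotient.on Sp.

Lemma pi_null x y : null (x - y) <-> \pi_Sp x = \pi_Sp y.
Proof. by split=> [xy|/eqmodP/asboolP //]; apply/eqmodP/asboolP. Qed.
End Hom.

(* The class of a combination of webs; locked, to keep unification from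
   unfolding the quotient.                                                    *)
HB.lock Definition Sp_class (K : fieldType) (qhalf : K) (eps del : seq sign)
  (x : {malg K[diagram eps del]}) : Sp qhalf eps del := \pi x.
Canonical Sp_class_unlock := Unlockable Sp_class.unlock.

Section HomTheory.
Variables (K : fieldType) (qhalf : K) (eps del : seq sign).
Local Notation comb := {malg K[diagram eps del]}.
Local Notation Sp := (Sp qhalf eps del).
Local Notation Sp_class := (@Sp_class K qhalf eps del).
Local Notation null := (@null K qhalf eps del).

Lemma Sp_class_repr f : Sp_class (repr f) = f.
Proof. by rewrite unlock reprK. Qed.

Lemma Sp_class_eq x y : Sp_class x = Sp_class y <-> null (x - y).
Proof. by rewrite unlock pi_null. Qed.

Lemma null_repr x : null (x - repr (Sp_class x)).
Proof. by apply/Sp_class_eq; rewrite Sp_class_repr. Qed.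

Definition Sp_add (f g : Sp) : Sp := Sp_class (repr f + repr g).
Definition Sp_opp (f : Sp) : Sp := Sp_class (- repr f).
Definition Sp_scale (c : K) (f : Sp) : Sp := Sp_class (c *: repr f).

Lemma Sp_addE x y : Sp_add (Sp_class x) (Sp_class y) = Sp_class (x + y).
Proof.
by apply/esym/Sp_class_eq; rewrite opprD addrACA; apply: nullD; exact: null_repr.
Qed.
Lemma Sp_oppE x : Sp_opp (Sp_class x) = Sp_class (- x).
Proof. by apply/esym/Sp_class_eq; rewrite -opprD; apply/nullN/null_repr. Qed.
Lemma Sp_scaleE c x : Sp_scale c (Sp_class x) = Sp_class (c *: x).
Proof. by apply/esym/Sp_class_eq; rewrite -scalerBr; apply/nullZ/null_repr. Qed.

Let classP f : exists x, f = Sp_class x.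
Proof. by exists (repr f); rewrite Sp_class_repr. Qed.

Lemma Sp_addA : associative Sp_add.
Proof.
by move=> f g k; have [[x ->] [y ->] [z ->]] := And3 (classP f) (classP g) (classP k);
   rewrite !Sp_addE addrA.
Qed.
Lemma Sp_addC : commutative Sp_add.
Proof.
by move=> f g; have [[x ->] [y ->]] := conj (classP f) (classP g);
   rewrite !Sp_addE addrC.
Qed.
Lemma Sp_add0 : left_id (Sp_class 0) Sp_add.
Proof. by move=> f; have [x ->] := classP f; rewrite Sp_addE add0r. Qed.
Lemma Sp_addN : left_inverse (Sp_class 0) Sp_opp Sp_add.
Proof. by move=> f; have [x ->] := classP f; rewrite Sp_oppE Sp_addE addNr. Qed.
HB.instance Definition _ :=
  GRing.isZmodule.Build Sp Sp_addA Sp_addC Sp_add0 Sp_addN.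

Lemma Sp_scaleA a b f : Sp_scale a (Sp_scale b f) = Sp_scale (a * b) f.
Proof. by have [x ->] := classP f; rewrite !Sp_scaleE scalerA. Qed.
Lemma Sp_scale1 : left_id 1 Sp_scale.
Proof. by move=> f; have [x ->] := classP f; rewrite Sp_scaleE scale1r. Qed.
Lemma Sp_scaleDr : right_distributive Sp_scale +%R.
Proof.
move=> c f g; have [[x ->] [y ->]] := conj (classP f) (classP g).
rewrite -[LHS]/(Sp_scale c (Sp_add _ _)) -[RHS]/(Sp_add _ _).
by rewrite Sp_addE !Sp_scaleE Sp_addE scalerDr.
Qed.
Lemma Sp_scaleDl f : {morph Sp_scale^~ f : a b / a + b}.
Proof.
move=> a b; have [x ->] := classP f.
by rewrite -[RHS]/(Sp_add _ _) !Sp_scaleE Sp_addE scalerDl.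
Qed.
HB.instance Definition _ := GRing.Zmodule_isLmodule.Build K Sp
  Sp_scaleA Sp_scale1 Sp_scaleDr Sp_scaleDl.

Lemma Sp_class_linear : linear Sp_class.
Proof. by move=> c x y; rewrite -[RHS]/(Sp_add (Sp_scale _ _) _) Sp_scaleE Sp_addE. Qed.
HB.instance Definition _ :=
  GRing.isLinear.Build K comb Sp *:%R Sp_class Sp_class_linear.

Lemma Sp_classD : {morph Sp_class : x y / x + y}. Proof. exact: linearD. Qed.
Lemma Sp_classB : {morph Sp_class : x y / x - y}. Proof. exact: linearB. Qed.
Lemma Sp_classZ c : {morph Sp_class : x / c *: x}. Proof. exact: linearZZ. Qed.

Lemma Sp_class_eq0 x : Sp_class x = 0 <-> null x.
Proof. by rewrite -[x in null x]subr0; exact: Sp_class_eq. Qed.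

Definition web (D : diagram eps del) : Sp := Sp_class << D >>.

Lemma Sp_ind (P : Sp -> Prop) :
  P 0 -> (forall c D f, P f -> P (c *: web D + f)) -> forall f, P f.
Proof.
move=> P0 PD f; rewrite -[f]Sp_class_repr.
elim/malg_ind: (repr f) => [|c D x Px]; rewrite ?linear0 // linearP; exact: PD.
Qed.

End HomTheory.

Section Embed.
Variables (K : fieldType) (qhalf : K) (eps del eps' del' : seq sign).
Local Notation web := (web qhalf).
Local Notation Sp_class := (Sp_class qhalf).
Variables (F : diagram eps del -> diagram eps' del') (P : place).
Hypothesis FE : forall D, F D = plug P D :> seq slice.

Let place_comp p := Place
  (p_below P ++ whisker (p_left P) (p_right P) (p_below p)) (p_left P ++ p_left p)
  (p_right p ++ p_right P) (whisker (p_left P) (p_right P) (p_above p) ++ p_above P).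

Let plug_comp p w : plug P (plug p w) = plug (place_comp p) w.
Proof.
rewrite /plug /whisker /= !map_cat -!catA; congr (_ ++ (_ ++ (_ ++ _))).
by rewrite -map_comp; apply: eq_map => -[[l g] r] /=; rewrite !catA.
Qed.

Let F_plug p w (D : diagram eps del) :
  D = plug p w :> seq slice -> F D = plug (place_comp p) w :> seq slice.
Proof. by rewrite FE => ->; rewrite plug_comp. Qed.

Lemma isotopic_embed D D' : isotopic D D' -> isotopic (F D) (F D').
Proof.
elim=> {D D'} [p w w' D D' ww' Dw Dw'|D|D D' _|D D' D'' _ h _].
- exact: isotopic_move ww' (F_plug Dw) (F_plug Dw').
- exact: isotopic_refl.
- exact: isotopic_sym.
- exact: isotopic_trans h.
Qed.

Lemma null_embed x : null qhalf x -> extend (fun D => web (F D)) x = 0.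
Proof.
pose phi : {linear {malg K[diagram eps del]} -> Sp qhalf eps' del'} :=
  extend (fun D => web (F D)); rewrite -/(phi x).
have phiU D : phi << D >> = Sp_class << F D >> by apply: extendU.
elim=> {x} [D D' /isotopic_embed FD
  |p s D D0 e e0|p s D D0 e e0
  |p s D D1 D2 e e1 e2||x y _ x0 _ y0|c x _ x0].
- rewrite linearB !phiU -Sp_classB; apply/Sp_class_eq0; exact: null_isotopy.
- rewrite linearB linearZZ !phiU -Sp_classZ -Sp_classB; apply/Sp_class_eq0.
  exact: null_loop (F_plug e) (F_plug e0).
- rewrite linearB linearZZ !phiU -Sp_classZ -Sp_classB; apply/Sp_class_eq0.
  exact: null_bigon (F_plug e) (F_plug e0).
- rewrite linearB [phi (_ + _)]linearD !phiU.
  rewrite -[X in _ - X]Sp_classD -Sp_classB; apply/Sp_class_eq0.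
  exact: null_square (F_plug e) (F_plug e1) (F_plug e2).
- exact: linear0.
- by rewrite linearD /= x0 y0 addr0.
- by rewrite linearZZ /= x0 scaler0.
Qed.
End Embed.

Lemma extendCA (K : fieldType) (A B : choiceType) (V : lmodType K) (op : A -> B -> V) x y :
  extend (fun a => extend (op a) y) x =
  extend (fun b => extend (op^~ b) x) y.
Proof.
rewrite /extend; under eq_bigr do rewrite scaler_sumr.
rewrite exchange_big; apply: eq_bigr => b _ /=; rewrite scaler_sumr.
by apply: eq_bigr => a _; rewrite !scalerA mulrC.
Qed.

(* The bilinear extension of an operation on webs. *)
HB.lock Definition bilin (K : fieldType) (qhalf : K)
    (e1 d1 e2 d2 e3 d3 : seq sign)
    (op : diagram e1 d1 -> diagram e2 d2 -> diagram e3 d3)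
    (f : Sp qhalf e1 d1) (g : Sp qhalf e2 d2) : Sp qhalf e3 d3 :=
  extend (fun D1 => extend (fun D2 => web qhalf (op D1 D2)) (repr g)) (repr f).
Canonical bilin_unlock := Unlockable bilin.unlock.

Section Bilinear.
Variables (K : fieldType) (qhalf : K) (e1 d1 e2 d2 e3 d3 : seq sign).
Variable op : diagram e1 d1 -> diagram e2 d2 -> diagram e3 d3.
Hypothesis opl :
  forall D2, exists P, forall D1, op D1 D2 = plug P D1 :> seq slice.
Hypothesis opr :
  forall D1, exists P, forall D2, op D1 D2 = plug P D2 :> seq slice.
Local Notation web := (web qhalf).
Local Notation Sp_class := (Sp_class qhalf).
Local Notation bilin := (@bilin K qhalf e1 d1 e2 d2 e3 d3 op).

Lemma bilinE x y : bilin (Sp_class x) (Sp_class y) =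
  extend (fun D1 => extend (fun D2 => web (op D1 D2)) y) x.
Proof.
rewrite unlock; transitivity
  (extend (fun D1 => extend (fun D2 => web (op D1 D2)) y) (repr (Sp_class x))).
  apply: eq_extend => D1; apply/eqP; rewrite eq_sym -subr_eq0 -linearB.
  have [P oP] := opr D1.
  by apply/eqP/(null_embed oP); exact: null_repr.
rewrite !(extendCA (fun D1 D2 => web (op D1 D2))).
apply: eq_extend => D2; apply/eqP; rewrite eq_sym -subr_eq0 -linearB.
have [P oP] := opl D2.
by apply/eqP/(null_embed oP); exact: null_repr.
Qed.

Lemma bilin_web D1 D2 : bilin (web D1) (web D2) = web (op D1 D2).
Proof. by rewrite bilinE !extendU. Qed.

Lemma bilinPl g c f f' : bilin (c *: f + f') g = c *: bilin f g + bilin f' g.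
Proof.
rewrite -[f]Sp_class_repr -[f']Sp_class_repr -[g]Sp_class_repr -linearP.
by rewrite !bilinE linearP.
Qed.

Lemma bilinPr f c g g' : bilin f (c *: g + g') = c *: bilin f g + bilin f g'.
Proof.
rewrite -[f]Sp_class_repr -[g]Sp_class_repr -[g']Sp_class_repr -linearP !bilinE.
rewrite -extend_linearl; apply: eq_extend => D1; exact: linearP.
Qed.

Lemma bilin0l g : bilin 0 g = 0.
Proof.
move: (bilinPl g 1 0 0).
by rewrite !scale1r addr0 => /esym/eqP; rewrite -subr_eq0 addrK => /eqP.
Qed.

Lemma bilin0r f : bilin f 0 = 0.
Proof.
move: (bilinPr f 1 0 0).
by rewrite !scale1r addr0 => /esym/eqP; rewrite -subr_eq0 addrK => /eqP.
Qed.
End Bilinear.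

Section Category.
Variables (K : fieldType) (qhalf : K).
Local Notation Sp := (Sp qhalf).
Local Notation web := (web qhalf).

Definition compose eps del gam (g : Sp del gam) (f : Sp eps del) : Sp eps gam :=
  bilin (@stack eps del gam) g f.

Definition tensor eps del eps' del' (f : Sp eps del) (g : Sp eps' del') :
  Sp (eps ++ eps') (del ++ del') := bilin (@juxtapose eps del eps' del') f g.

Definition idm eps : Sp eps eps := web (id_diagram eps).
End Category.

Notation "g \circ f" := (compose g f) (at level 39, left associativity).
Notation "f \ox g" := (tensor f g) (at level 38, left associativity).

Section CategoryTheory.
Variables (K : fieldType) (qhalf : K).
Local Notation Sp := (Sp qhalf).
Local Notation web := (web qhalf).
Local Notation idm := (idm qhalf).

Lemma whisker0 w : whisker [::] [::] w = w.
Proof.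
by rewrite -[RHS]map_id; apply: eq_map => -[[l g] r] /=; rewrite cats0.
Qed.

Lemma stack_plugl eps del gam (D : diagram eps del) :
  exists P, forall D' : diagram del gam, stack D' D = plug P D' :> seq slice.
Proof.
by exists (Place D [::] [::] [::]) => D'; rewrite /plug whisker0 cats0.
Qed.
Lemma stack_plugr eps del gam (D' : diagram del gam) :
  exists P, forall D : diagram eps del, stack D' D = plug P D :> seq slice.
Proof. by exists (Place [::] [::] [::] D') => D; rewrite /plug whisker0. Qed.
Lemma juxtapose_plugl eps del eps' del' (D' : diagram eps' del') :
  exists P, forall D : diagram eps del,
    juxtapose D D' = plug P D :> seq slice.
Proof. by exists (Place [::] [::] eps' (whisker del [::] D')). Qed.
Lemma juxtapose_plugr eps del eps' del' (D : diagram eps del) :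
  exists P, forall D' : diagram eps' del',
    juxtapose D D' = plug P D' :> seq slice.
Proof.
by exists (Place (whisker [::] eps' D) del [::] [::]) => D'; rewrite /plug cats0.
Qed.

Section Compose.
Context {eps del gam : seq sign}.
Implicit Types (f : Sp eps del) (g : Sp del gam).
Let sl := @stack_plugl eps del gam.
Let sr := @stack_plugr eps del gam.

Lemma compose_web (D' : diagram del gam) (D : diagram eps del) :
  web D' \circ web D = web (stack D' D).
Proof. exact: bilin_web sl sr _ _. Qed.
Lemma composePl f c g g' : (c *: g + g') \circ f = c *: (g \circ f) + g' \circ f.
Proof. exact: bilinPl sl sr _ _ _ _. Qed.
Lemma composePr g c f f' : g \circ (c *: f + f') = c *: (g \circ f) + g \circ f'.
Proof. exact: bilinPr sl sr _ _ _ _. Qed.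
Lemma compose0l f : compose (0 : Sp del gam) f = 0.
Proof. exact: bilin0l sl sr _. Qed.
Lemma compose0r g : compose g (0 : Sp eps del) = 0.
Proof. exact: bilin0r sl sr _. Qed.
End Compose.

Section Tensor.
Context {eps del eps' del' : seq sign}.
Implicit Types (f : Sp eps del) (g : Sp eps' del').
Let sl := @juxtapose_plugl eps del eps' del'.
Let sr := @juxtapose_plugr eps del eps' del'.

Lemma tensor_web (D : diagram eps del) (D' : diagram eps' del') :
  web D \ox web D' = web (juxtapose D D').
Proof. exact: bilin_web sl sr _ _. Qed.
Lemma tensorPl g c f f' : (c *: f + f') \ox g = c *: (f \ox g) + f' \ox g.
Proof. exact: bilinPl sl sr _ _ _ _. Qed.
Lemma tensorPr f c g g' : f \ox (c *: g + g') = c *: (f \ox g) + f \ox g'.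
Proof. exact: bilinPr sl sr _ _ _ _. Qed.
Lemma tensor0l g : tensor (0 : Sp eps del) g = 0.
Proof. exact: bilin0l sl sr _. Qed.
Lemma tensor0r f : tensor f (0 : Sp eps' del') = 0.
Proof. exact: bilin0r sl sr _. Qed.
End Tensor.

Lemma composeA eps del gam the
    (k : Sp gam the) (g : Sp del gam) (f : Sp eps del) :
  k \circ (g \circ f) = k \circ g \circ f.
Proof.
elim/Sp_ind: k => [|c D3 k IHk]; first by rewrite !compose0l.
rewrite !composePl IHk.
suff -> : web D3 \circ (g \circ f) = web D3 \circ g \circ f by [].
elim/Sp_ind: g {IHk} => [|b D2 g IHg].
  by rewrite compose0l !compose0r compose0l.
rewrite composePl !composePr composePl IHg.
suff -> : web D3 \circ (web D2 \circ f) = web D3 \circ web D2 \circ f by [].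
elim/Sp_ind: f {IHg} => [|a D f IHf]; first by rewrite !compose0r.
rewrite !composePr IHf !compose_web.
suff -> : stack D3 (stack D2 D) = stack (stack D3 D2) D by [].
by apply: val_inj; rewrite /= catA.
Qed.

Lemma compose1l eps del (f : Sp eps del) : idm del \circ f = f.
Proof.
elim/Sp_ind: f => [|a D f IHf]; first exact: compose0r.
rewrite composePr IHf compose_web.
suff -> : stack (id_diagram del) D = D by [].
by apply: val_inj; rewrite /= cats0.
Qed.

Lemma compose1r eps del (f : Sp eps del) : f \circ idm eps = f.
Proof.
elim/Sp_ind: f => [|a D f IHf]; first exact: compose0l.
rewrite composePl IHf compose_web.
suff -> : stack D (id_diagram eps) = D by [].
exact: val_inj.
Qed.

Lemma web_isotopic eps del (D D' : diagram eps del) :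
  isotopic D D' -> web D = web D'.
Proof. by move=> h; apply/Sp_class_eq; apply: null_isotopy. Qed.

End CategoryTheory.

Section Exchange.

Definition seg_iso (a b : seq sign) (w w' : seq slice) := forall x y u v
  (D D' : diagram x y), is_diagram x u a -> is_diagram b v y ->
  D = u ++ w ++ v :> seq slice -> D' = u ++ w' ++ v :> seq slice ->
  isotopic D D'.

Lemma seg_iso_refl a b w : seg_iso a b w w.
Proof.
move=> x y u v D D' _ _ e e'; suff -> : D = D' by exact: isotopic_refl.
by apply: val_inj; rewrite /= e e'.
Qed.

Lemma seg_iso_trans a b w1 w2 w3 : is_diagram a w2 b ->
  seg_iso a b w1 w2 -> seg_iso a b w2 w3 -> seg_iso a b w1 w3.
Proof.
move=> d2 h12 h23 x y u v D D' du dv e e'.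
pose D2 := Diagram (is_diagram_cat du (is_diagram_cat d2 dv)).
by apply: (isotopic_trans (h12 _ _ u v D D2 _ _ _ _) (h23 _ _ u v D2 D' _ _ _ _)).
Qed.

Lemma seg_iso_catl a b c w0 w w' : is_diagram a w0 b ->
  seg_iso b c w w' -> seg_iso a c (w0 ++ w) (w0 ++ w').
Proof.
move=> d0 h x y u v D D' du dv e e'; apply: (h _ _ (u ++ w0) v) => //.
- exact: is_diagram_cat d0.
- by rewrite e !catA.
- by rewrite e' !catA.
Qed.

Lemma seg_iso_catr a b c w0 w w' : is_diagram b w0 c ->
  seg_iso a b w w' -> seg_iso a c (w ++ w0) (w' ++ w0).
Proof.
move=> d0 h x y u v D D' du dv e e'; apply: (h _ _ u (w0 ++ v)) => //.
- exact: is_diagram_cat dv.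
- by rewrite e !catA.
- by rewrite e' !catA.
Qed.

Lemma is_diagram_whiskerl l eps w del : is_diagram eps w del ->
  is_diagram (l ++ eps) (whisker l [::] w) (l ++ del).
Proof. by move/(is_diagram_whisker l [::]); rewrite !cats0. Qed.
Lemma is_diagram_whiskerr r eps w del : is_diagram eps w del ->
  is_diagram (eps ++ r) (whisker [::] r w) (del ++ r).
Proof. exact: (is_diagram_whisker [::] r). Qed.

Lemma exchange11 x y del gam eps' del' :
  is_diagram del [:: x] gam -> is_diagram eps' [:: y] del' ->
  seg_iso (del ++ eps') (gam ++ del')
    (whisker del [::] [:: y] ++ whisker [::] del' [:: x])
    (whisker [::] eps' [:: x] ++ whisker gam [::] [:: y]).
Proof.
case: x => [[l g] r]; case: y => [[l' g'] r'] /=.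
case/andP=> /eqP-> /eqP<- /andP[/eqP-> /eqP<-] a b u v D D' _ _ e e'.
apply: isotopic_sym.
apply: (@isotopic_move _ _ (Place u l r' v) _ _ D' D (IsoExchange g (r ++ l') g')).
  by rewrite e' /plug /= !cats0 -!catA.
by rewrite e /plug /= !cats0 -!catA.
Qed.

Lemma exchange1 x wF del gam eps' del' :
  is_diagram del [:: x] gam -> is_diagram eps' wF del' ->
  seg_iso (del ++ eps') (gam ++ del')
    (whisker del [::] wF ++ whisker [::] del' [:: x])
    (whisker [::] eps' [:: x] ++ whisker gam [::] wF).
Proof.
move=> dx; elim: wF eps' => [|y wF IHw] eps'.
  by move=> /= /eqP->; exact: seg_iso_refl.
case: y => [[l g] r] /= /andP[/eqP-> dF].
set z := l ++ elem_top g ++ r.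
have dy : is_diagram (l ++ elem_bot g ++ r) [:: (l, g, r)] z by rewrite /= !eqxx.
have ex1 := exchange11 dx dy.
have ex2 := IHw _ dF.
have t1 := seg_iso_catl (is_diagram_whiskerl del dy) ex2.
have t2 := seg_iso_catr (is_diagram_whiskerl gam dF) ex1.
rewrite -!catA in t2; apply: seg_iso_trans t1 t2.
apply: is_diagram_cat (is_diagram_whiskerl del dy) _.
apply: is_diagram_cat (is_diagram_whiskerr z dx) _.
exact: is_diagram_whiskerl.
Qed.

Lemma exchange wG wF del gam eps' del' :
  is_diagram del wG gam -> is_diagram eps' wF del' ->
  seg_iso (del ++ eps') (gam ++ del')
    (whisker del [::] wF ++ whisker [::] del' wG)
    (whisker [::] eps' wG ++ whisker gam [::] wF).
Proof.
move=> + dF; elim: wG del => [|x wG IHw] del.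
  by move=> /= /eqP->; rewrite cats0; exact: seg_iso_refl.
case: x => [[l g] r] /= /andP[/eqP-> dG].
set z := l ++ elem_top g ++ r.
have dx : is_diagram (l ++ elem_bot g ++ r) [:: (l, g, r)] z by rewrite /= !eqxx.
have ex1 := exchange1 dx dF.
have ex2 := IHw _ dG.
have t1 := seg_iso_catr (is_diagram_whiskerr del' dG) ex1.
have t2 := seg_iso_catl (is_diagram_whiskerr eps' dx) ex2.
rewrite -[X in seg_iso _ _ X _]catA -[X in seg_iso _ _ _ X]catA in t1.
apply: seg_iso_trans t1 t2.
apply: is_diagram_cat (is_diagram_whiskerr eps' dx) _.
apply: is_diagram_cat (is_diagram_whiskerl z dF) _.
exact: is_diagram_whiskerr.
Qed.

Lemma stack_juxtapose eps del gam eps' del' gam'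
    (G : diagram del gam) (F : diagram eps del)
    (G' : diagram del' gam') (F' : diagram eps' del') :
  isotopic (stack (juxtapose G G') (juxtapose F F'))
           (juxtapose (stack G F) (stack G' F')).
Proof.
apply: (exchange (diagramP G) (diagramP F') (u := whisker [::] eps' F)
          (v := whisker gam [::] G')).
- exact: is_diagram_whiskerr (diagramP F).
- exact: is_diagram_whiskerl (diagramP G').
- by rewrite /= -!catA.
- by rewrite /= /whisker !map_cat -!catA.
Qed.
End Exchange.

Section Interchange.
Variables (K : fieldType) (qhalf : K).
Local Notation Sp := (Sp qhalf).

Lemma tensor_compose eps del gam eps' del' gam'
    (g : Sp del gam) (f : Sp eps del) (g' : Sp del' gam') (f' : Sp eps' del') :
  (g \ox g') \circ (f \ox f') = (g \circ f) \ox (g' \circ f').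
Proof.
elim/Sp_ind: g => [|a G g IH].
  by rewrite tensor0l !compose0l tensor0l.
rewrite tensorPl !composePl tensorPl IH.
suff -> : (web qhalf G \ox g') \circ (f \ox f') =
          (web qhalf G \circ f) \ox (g' \circ f') by [].
elim/Sp_ind: f {IH} => [|b F f IH].
  by rewrite tensor0l !compose0r tensor0l.
rewrite tensorPl !composePr tensorPl IH.
suff -> : (web qhalf G \ox g') \circ (web qhalf F \ox f') =
          (web qhalf G \circ web qhalf F) \ox (g' \circ f') by [].
elim/Sp_ind: g' {IH} => [|c G' g' IH].
  by rewrite tensor0r !compose0l tensor0r.
rewrite tensorPr !composePl tensorPr IH.
suff -> : (web qhalf G \ox web qhalf G') \circ (web qhalf F \ox f') =
          (web qhalf G \circ web qhalf F) \ox (web qhalf G' \circ f') by [].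
elim/Sp_ind: f' {IH} => [|d F' f' IH].
  by rewrite tensor0r !compose0r tensor0r.
rewrite tensorPr !composePr tensorPr IH.
suff -> : (web qhalf G \ox web qhalf G') \circ (web qhalf F \ox web qhalf F') =
          (web qhalf G \circ web qhalf F) \ox (web qhalf G' \circ web qhalf F')
  by [].
by rewrite !(tensor_web, compose_web); apply/web_isotopic/stack_juxtapose.
Qed.
End Interchange.

Section Clasps.
Variables (K : fieldType) (qhalf : K).
Local Notation Sp := (Sp qhalf).
Local Notation idm := (idm qhalf).
Local Notation qint := (qint qhalf).
Local Notation qbinom := (qbinom qhalf).

Definition cast_end eps del (e : eps = del) (f : Sp eps eps) : Sp del del :=
  ecast z (Sp z z) e f.

Lemma nseq_rcons k (s : sign) : nseq k s ++ [:: s] = nseq k.+1 s.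
Proof. by elim: k => //= k ->. Qed.

Lemma nseq_rcons2 k (s : sign) : nseq k s ++ [:: s; s] = nseq k.+2 s.
Proof. by elim: k => //= k ->. Qed.

(* From the clasp of s^k to that of s^(k+1). *)
Definition clasp_step (s : sign) (k : nat) :
    Sp (nseq k s) (nseq k s) -> Sp (nseq k.+1 s) (nseq k.+1 s) :=
  match k with
  | 0 => fun _ => idm [:: s]
  | k'.+1 => fun Q =>
      let P := cast_end (nseq_rcons k'.+1 s) (Q \ox idm [:: s]) in
      let T := cast_end (nseq_rcons2 k' s)
        (idm (nseq k' s) \ox
           (web qhalf (split_diagram s) \circ web qhalf (merge_diagram s))) in
      P - (qint k'.+1 / qint k'.+2) *: (P \circ T \circ P)
  end.

(* The clasp of s^k; reversing the edges of all webs exchanges the two values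
   of s.                                                                      *)
Fixpoint clasp1 (s : sign) (k : nat) : Sp (nseq k s) (nseq k s) :=
  if k is k'.+1 then clasp_step (clasp1 s k') else idm [::].

Definition posneg (k l : nat) : seq sign := nseq k true ++ nseq l false.

Lemma posneg_split k l (i : 'I_(minn k l).+1) :
  nseq (k - i) true ++ (nseq i true ++ nseq i false) ++ nseq (l - i) false =
  posneg k l.
Proof.
have := ltn_ord i; rewrite ltnS leq_min => /andP[ik il].
by rewrite /posneg -!catA -nseqD subnKC // catA -nseqD subnK.
Qed.

Definition cupcap (k l : nat) (i : 'I_(minn k l).+1) :
    Sp (posneg k l) (posneg k l) :=
  cast_end (posneg_split i)
    (idm (nseq (k - i) true) \ox
       ((web qhalf (cups i) \circ web qhalf (caps i)) \ox
          idm (nseq (l - i) false))).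

Definition clasp (k l : nat) : Sp (posneg k l) (posneg k l) :=
  let P := clasp1 true k \ox clasp1 false l in
  \sum_(i < (minn k l).+1)
    ((-1) ^+ i * (qbinom k i * qbinom l i / qbinom (k + l + 1) i)) *:
      (P \circ cupcap i \circ P).
End Clasps.

Section Karoubi.
Variables (K : fieldType) (qhalf : K).
Local Notation Sp := (Sp qhalf).
Local Notation idm := (idm qhalf).

Record kar_obj := KarObj {
  kar_dom : seq sign;
  kar_idem : Sp kar_dom kar_dom;
  kar_idemP : kar_idem \circ kar_idem = kar_idem }.

Definition is_kar_hom (A B : kar_obj) (phi : Sp (kar_dom A) (kar_dom B)) :=
  kar_idem B \circ phi \circ kar_idem A = phi.

Lemma kar_tensor_subproof (A B : kar_obj) :
  (kar_idem A \ox kar_idem B) \circ (kar_idem A \ox kar_idem B) =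
  kar_idem A \ox kar_idem B.
Proof. by rewrite tensor_compose !kar_idemP. Qed.
Definition kar_tensor (A B : kar_obj) : kar_obj :=
  KarObj (kar_tensor_subproof A B).

Definition kar_of (Z : seq sign) : kar_obj := KarObj (compose1l (idm Z)).

(* [(Z, f)] if f is idempotent, and the zero object [(Z, 0)] otherwise.  It is
   only applied to clasps, which are idempotents.                             *)
Definition kar_image (Z : seq sign) (f : Sp Z Z) : kar_obj :=
  match pselect (f \circ f = f) with
  | left ff => KarObj ff
  | right _ => KarObj (compose0l (0 : Sp Z Z))
  end.

(* Formal finite direct sums, with matrices as morphisms; [phi i j] goes from
   the i-th summand of A to the j-th summand of B.                            *)
Definition add_obj : Type := seq kar_obj.

Definition summand (A : add_obj) (i : 'I_(size A)) : kar_obj :=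
  tnth (in_tuple A) i.

Definition add_mx (A B : add_obj) : Type := forall i j,
  Sp (kar_dom (@summand A i)) (kar_dom (@summand B j)).

Definition is_add_hom A B (phi : add_mx A B) :=
  forall i j, is_kar_hom (phi i j).

Definition add_comp A B C (psi : add_mx B C) (phi : add_mx A B) : add_mx A C :=
  fun i k => \sum_j (psi j k \circ phi i j).

Definition is_add_id A (theta : add_mx A A) :=
  (forall i, theta i i = kar_idem (summand i)) /\
  (forall i j, i != j -> theta i j = 0).

Definition add_iso (A B : add_obj) :=
  exists (phi : add_mx A B) (psi : add_mx B A),
    [/\ is_add_hom phi, is_add_hom psi,
        is_add_id (add_comp psi phi) & is_add_id (add_comp phi psi)].

Definition add_tensor (A B : add_obj) : add_obj :=
  [seq kar_tensor a b | a <- A, b <- B].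
End Karoubi.

(* Associative unital rings presented by generators and relations. *)
Inductive ring_term (G : Type) : Type :=
| RGen of G | RZero | ROne | ROpp of ring_term G
| RAdd of ring_term G & ring_term G | RMul of ring_term G & ring_term G.
Arguments RZero {G}.
Arguments ROne {G}.
HB.instance Definition _ (G : Type) := gen_eqMixin (ring_term G).
HB.instance Definition _ (G : Type) := gen_choiceMixin (ring_term G).

Section PresentedRing.
Variables (G : Type) (rel : ring_term G -> ring_term G -> Prop).

Inductive ring_cong : ring_term G -> ring_term G -> Prop :=
| rc_rel x y : rel x y -> ring_cong x y
| rc_refl x : ring_cong x x
| rc_sym x y : ring_cong x y -> ring_cong y x
| rc_trans x y z : ring_cong x y -> ring_cong y z -> ring_cong x z
| rc_opp x x' : ring_cong x x' -> ring_cong (ROpp x) (ROpp x')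
| rc_add x x' y y' : ring_cong x x' -> ring_cong y y' ->
    ring_cong (RAdd x y) (RAdd x' y')
| rc_mul x x' y y' : ring_cong x x' -> ring_cong y y' ->
    ring_cong (RMul x y) (RMul x' y')
| rc_addA x y z : ring_cong (RAdd x (RAdd y z)) (RAdd (RAdd x y) z)
| rc_addC x y : ring_cong (RAdd x y) (RAdd y x)
| rc_add0 x : ring_cong (RAdd RZero x) x
| rc_addN x : ring_cong (RAdd (ROpp x) x) RZero
| rc_mulA x y z : ring_cong (RMul x (RMul y z)) (RMul (RMul x y) z)
| rc_mul1l x : ring_cong (RMul ROne x) x
| rc_mul1r x : ring_cong (RMul x ROne) x
| rc_mulDl x y z : ring_cong (RMul (RAdd x y) z) (RAdd (RMul x z) (RMul y z))
| rc_mulDr x y z : ring_cong (RMul x (RAdd y z)) (RAdd (RMul x y) (RMul x z)).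

Definition ring_congb : ssrbool.rel (ring_term G) := fun x y => `[< ring_cong x y >].

Lemma ring_congb_equiv : equiv_class_of ring_congb.
Proof.
split=> [x|x y|y x z].
- by apply/asboolP; apply: rc_refl.
- by apply/asboolP/asboolP; apply: rc_sym.
- by move=> /asboolP xy /asboolP yz; apply/asboolP; apply: rc_trans yz.
Qed.
Canonical ring_cong_equiv := EquivRelPack ring_congb_equiv.
Canonical ring_cong_equiv_direct := defaultEncModRel ring_congb.

Definition presented_ring := {eq_quot ring_congb}.
HB.instance Definition _ := Choice.on presented_ring.
HB.instance Definition _ := EqQuotient.on presented_ring.

Lemma pi_ring_cong x y :
  ring_cong x y <-> \pi_presented_ring x = \pi_presented_ring y.
Proof. by split=> [xy|/eqmodP/asboolP //]; apply/eqmodP/asboolP. Qed.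
End PresentedRing.

HB.lock Definition ring_class (G : Type)
  (rel : ring_term G -> ring_term G -> Prop) (x : ring_term G) :
  presented_ring rel := \pi x.
Canonical ring_class_unlock := Unlockable ring_class.unlock.

Section PresentedRingTheory.
Variables (G : Type) (rel : ring_term G -> ring_term G -> Prop).
Local Notation PR := (presented_ring rel).
Local Notation cl := (@ring_class G rel).

Lemma ring_class_repr (a : PR) : cl (repr a) = a.
Proof. by rewrite unlock reprK. Qed.

Lemma ring_class_eq x y : cl x = cl y <-> ring_cong rel x y.
Proof. by rewrite unlock pi_ring_cong. Qed.

Lemma repr_ring_cong x : ring_cong rel (repr (cl x)) x.
Proof. by apply/ring_class_eq; rewrite ring_class_repr. Qed.

Definition pr_add (a b : PR) : PR := cl (RAdd (repr a) (repr b)).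
Definition pr_mul (a b : PR) : PR := cl (RMul (repr a) (repr b)).
Definition pr_opp (a : PR) : PR := cl (ROpp (repr a)).

Lemma pr_addE x y : pr_add (cl x) (cl y) = cl (RAdd x y).
Proof. by apply/ring_class_eq; apply: rc_add; exact: repr_ring_cong. Qed.
Lemma pr_mulE x y : pr_mul (cl x) (cl y) = cl (RMul x y).
Proof. by apply/ring_class_eq; apply: rc_mul; exact: repr_ring_cong. Qed.
Lemma pr_oppE x : pr_opp (cl x) = cl (ROpp x).
Proof. by apply/ring_class_eq; apply: rc_opp; exact: repr_ring_cong. Qed.

Let clP (a : PR) : exists x, a = cl x.
Proof. by exists (repr a); rewrite ring_class_repr. Qed.

Lemma pr_addA : associative pr_add.
Proof.
move=> a b c; case: (clP a) (clP b) (clP c) => [x ->] [y ->] [z ->].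
by rewrite !pr_addE; apply/ring_class_eq/rc_addA.
Qed.
Lemma pr_addC : commutative pr_add.
Proof.
move=> a b; case: (clP a) (clP b) => [x ->] [y ->].
by rewrite !pr_addE; apply/ring_class_eq/rc_addC.
Qed.
Lemma pr_add0 : left_id (cl RZero) pr_add.
Proof.
by move=> a; case: (clP a) => [x ->]; rewrite pr_addE; apply/ring_class_eq/rc_add0.
Qed.
Lemma pr_addN : left_inverse (cl RZero) pr_opp pr_add.
Proof.
move=> a; case: (clP a) => [x ->].
by rewrite pr_oppE pr_addE; apply/ring_class_eq/rc_addN.
Qed.
HB.instance Definition _ :=
  GRing.isZmodule.Build PR pr_addA pr_addC pr_add0 pr_addN.

Lemma pr_mulA : associative pr_mul.
Proof.
move=> a b c; case: (clP a) (clP b) (clP c) => [x ->] [y ->] [z ->].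
by rewrite !pr_mulE; apply/ring_class_eq/rc_mulA.
Qed.
Lemma pr_mul1l : left_id (cl ROne) pr_mul.
Proof.
by move=> a; case: (clP a) => [x ->]; rewrite pr_mulE; apply/ring_class_eq/rc_mul1l.
Qed.
Lemma pr_mul1r : right_id (cl ROne) pr_mul.
Proof.
by move=> a; case: (clP a) => [x ->]; rewrite pr_mulE; apply/ring_class_eq/rc_mul1r.
Qed.
Lemma pr_mulDl : left_distributive pr_mul +%R.
Proof.
move=> a b c; case: (clP a) (clP b) (clP c) => [x ->] [y ->] [z ->].
rewrite -[LHS]/(pr_mul (pr_add _ _) _) -[RHS]/(pr_add _ _).
by rewrite pr_addE !pr_mulE pr_addE; apply/ring_class_eq/rc_mulDl.
Qed.
Lemma pr_mulDr : right_distributive pr_mul +%R.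
Proof.
move=> a b c; case: (clP a) (clP b) (clP c) => [x ->] [y ->] [z ->].
rewrite -[LHS]/(pr_mul _ (pr_add _ _)) -[RHS]/(pr_add _ _).
by rewrite pr_addE !pr_mulE pr_addE; apply/ring_class_eq/rc_mulDr.
Qed.
HB.instance Definition _ := GRing.Zmodule_isPzRing.Build PR
  pr_mulA pr_mul1l pr_mul1r pr_mulDl pr_mulDr.
End PresentedRingTheory.

Section GrothendieckRing.
Variables (K : fieldType) (qhalf : K).
Local Notation add_obj := (add_obj qhalf).

Inductive K0_rel : ring_term add_obj -> ring_term add_obj -> Prop :=
| K0_iso A B : add_iso A B -> K0_rel (RGen A) (RGen B)
| K0_sum A B : K0_rel (RGen (A ++ B)) (RAdd (RGen A) (RGen B))
| K0_tensor A B : K0_rel (RGen (add_tensor A B)) (RMul (RGen A) (RGen B))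
| K0_unit : K0_rel (RGen [:: kar_of qhalf [::]]) ROne.

Definition K0 : pzRingType := presented_ring K0_rel.

Definition K0_class (A : kar_obj qhalf) : K0 := ring_class K0_rel (RGen [:: A]).
End GrothendieckRing.

(* C(q^{1/6}); the indeterminate is q^{1/6}. *)
Definition Cq (R : realType) : fieldType := {fraction {poly R[i]}}.
Definition Cq_qhalf (R : realType) : Cq R := tofrac ('X ^+ 3).

Definition clasp_obj (R : realType) (k l : nat) : kar_obj (Cq_qhalf R) :=
  kar_image (clasp (Cq_qhalf R) k l).

(* Main.v *)
(* Write S_k and T_l for the classes of the clasps of (+)^k and (-)^l, so that
   X = S_1 and T_1 are the classes of the two strands.
   - The rungs on k parallel strands satisfy the Hecke relations, so the clasp of
     (+)^k is the idempotent killed by all rungs; this makes the recursion for it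
     left-right symmetric.
   - Bending a cap through (+)^(k+1) (-)^(l+1) gives a morphism to (+)^k (-)^l
     whose composite with its mirror image is invertible on the clasps, by an
     explicit alternating sum; the complementary idempotent is the clasp of
     (+)^(k+1) (-)^(l+1). Hence S_(k+1) T_(l+1) = <P_(k+1,l+1)> + S_k T_l.
   - Likewise, splitting off a vertex gives S_(k+1) X = S_(k+2) + <P_(k,1)>.
   - The webs + - -> - + and - + -> + - shaped like the letter H are invertible
     because 1 + [3] = [2]^2 <> 0, so X and T_1 commute, and then so do all the
     S_k and T_l, being polynomials in X and T_1.
   The theorem follows by expanding both sides in the S_k and T_l.            *)
From HB Require Import structures.
Require Import Defs.
From mathcomp Require Import all_boot all_order all_algebra.
From mathcomp Require Import fraction complex zify ring.
From mathcomp Require Import boolp reals.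

Set Implicit Arguments.
Unset Strict Implicit.
Unset Printing Implicit Defensive.

Import GRing.Theory.
Local Open Scope ring_scope.

(** The cap joins the last + strand to the first - strand, while the definition of the clasp of
    (-)^(l+1) peels off its last strand. Evaluating the capped clasps requires peeling off the first
    one, which is why the left-right symmetry is proved, by way of the Hecke algebra. The capped
    product of clasps acts on the webs with j nested turnbacks as a bidiagonal operator, sending the
    j-th to a combination of the j-th and the (j+1)-st. A telescoping sum inverts it, and the ratios
    that this forces on the coefficients are those of the q-binomial quotients in the definition of
    the clasp. Idempotence of the clasp comes out of the same computation, so that [kar_image] of a
    clasp is the intended object. K_0 is presented as a ring that may be noncommutative, so the
    order of the factors has to be changed by an isomorphism of webs. The argument works over any
    field in which the quantum integers [n], n >= 1, are nonzero. *)

(** * Quantum integers *)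

Section QuantumIntegerTheory.
Variables (K : fieldType) (qhalf : K).
Local Notation qint := (qint qhalf).
Hypothesis qint_neq0 : forall n, qint n.+1 != 0.

Let qsub_neq0 : qhalf - qhalf^-1 != 0.
Proof. by apply: contraNneq (qint_neq0 0) => e; rewrite /qint e invr0 mulr0. Qed.

Let qhalf_neq0 : qhalf != 0.
Proof. by apply: contraNneq qsub_neq0 => ->; rewrite invr0 subrr. Qed.

Lemma qint0 : qint 0 = 0.
Proof. by rewrite /qint !expr0 invr1 subrr mul0r. Qed.

Lemma qint1 : qint 1 = 1.
Proof. by rewrite /qint !expr1 divff. Qed.

(** The source of the relations between quantum integers used below; [a = 1] gives the three-term
    recursion. *)
Lemma qint_mulS a b : qint a.+1 * qint b.+1 = qint a * qint b + qint (a + b).+1.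
Proof.
rewrite /qint -!exprVn !exprS exprD exprD; move: qsub_neq0.
move: (qhalf ^+ a) (qhalf ^+ b) (_ ^+ a) (_ ^+ b) => A B C D d0.
field; rewrite qhalf_neq0 /=; apply: contraNneq d0 => /(canRL (addrK _)) d0.
suff <- : qhalf = qhalf^-1 by rewrite subrr.
by apply: (mulfI qhalf_neq0); rewrite d0 sub0r opprK mulfV.
Qed.

Lemma qintSS n : qint n.+2 = qint 2 * qint n.+1 - qint n.
Proof. by rewrite (qint_mulS 1 n) qint1 mul1r add1n addrAC subrr add0r. Qed.

Lemma qint3 : qint 3 = qint 2 * qint 2 - 1.
Proof. by rewrite qintSS qint1. Qed.
End QuantumIntegerTheory.

(** * The calculus of webs *)

(* The part of the structure of the spider that the proof uses; the spaces of
   morphisms are abstract, since conversion would otherwise unfold the quotients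
   defining [Sp].                                                             *)
Record calculus (K : fieldType) (qhalf : K) := Calculus {
  Hom : seq sign -> seq sign -> lmodType K;
  comp : forall a b c, Hom b c -> Hom a b -> Hom a c;
  one : forall a, Hom a a;
  compA : forall a b c d (k : Hom c d) (g : Hom b c) (f : Hom a b),
    comp k (comp g f) = comp (comp k g) f;
  comp1l : forall a b (f : Hom a b), comp (one b) f = f;
  comp1r : forall a b (f : Hom a b), comp f (one a) = f;
  compPl : forall a b c (f : Hom a b) x (g g' : Hom b c),
    comp (x *: g + g') f = x *: comp g f + comp g' f;
  compPr : forall a b c (g : Hom b c) x (f f' : Hom a b),
    comp g (x *: f + f') = x *: comp g f + comp g f';
  (* [wh l r f] is [1_l (x) f (x) 1_r], with source and target rewritten along
     equalities of words of signs; its value is junk if the words differ.      *)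
  wh : forall (l r : seq sign) {a b a' b'}, Hom a b -> Hom a' b';
  whP : forall l r a b a' b' x (f g : Hom a b),
    wh l r (x *: f + g) = x *: wh l r f + wh l r g :> Hom a' b';
  wh_one : forall l r a a', a' = l ++ a ++ r -> wh l r (one a) = one a';
  wh_nil : forall a b (f : Hom a b), wh [::] [::] f = f;
  wh_comp : forall l r a b c a' b' c' (g : Hom b c) (f : Hom a b),
    a' = l ++ a ++ r -> b' = l ++ b ++ r -> c' = l ++ c ++ r ->
    wh l r (comp g f) = comp (wh l r g : Hom b' c') (wh l r f : Hom a' b');
  wh_wh : forall l r l' r' a b a1 b1 a2 b2 (f : Hom a b),
    a1 = l' ++ a ++ r' -> b1 = l' ++ b ++ r' ->
    a2 = l ++ a1 ++ r -> b2 = l ++ b1 ++ r ->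
    wh l r (wh l' r' f : Hom a1 b1) = wh (l ++ l') (r' ++ r) f :> Hom a2 b2;
  wh_exchange : forall l m r l1 l2 r1 r2 a b c d x y z t
      (f : Hom a b) (g : Hom c d),
    l1 = l ++ a ++ m -> l2 = l ++ b ++ m ->
    r1 = m ++ c ++ r -> r2 = m ++ d ++ r ->
    x = l ++ a ++ m ++ c ++ r -> y = l ++ b ++ m ++ c ++ r ->
    z = l ++ a ++ m ++ d ++ r -> t = l ++ b ++ m ++ d ++ r ->
    comp (wh l2 r g : Hom y t) (wh l r1 f : Hom x y) =
    comp (wh l r2 f : Hom z t) (wh l1 r g : Hom x z);
  fuse : forall s t, Hom [:: s; s] [:: t];
  fork : forall s t, Hom [:: t] [:: s; s];
  cup : forall s t, Hom [::] [:: s; t];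
  cap : forall s t, Hom [:: s; t] [::];
  cap_cup : forall s t, t = ~~ s ->
    comp (cap s t) (cup s t) = qint qhalf 3 *: one [::];
  fuse_fork : forall s t, t = ~~ s ->
    comp (fuse s t) (fork s t) = qint qhalf 2 *: one [:: t];
  square : forall s t, t = ~~ s ->
    comp (comp (wh [:: s] [::] (fuse s t))
               (wh [::] [:: s] (fork s t) : Hom [:: t; s] [:: s; s; s]))
         (comp (wh [::] [:: s] (fuse s t) : Hom [:: s; s; s] [:: t; s])
               (wh [:: s] [::] (fork s t) : Hom _ [:: s; s; s])) =
    one [:: s; t] + comp (cup s t) (cap s t);
  fuse_bend : forall s t, t = ~~ s ->
    comp (wh [::] [:: t] (fuse s t)) (wh [:: s] [::] (cup s t) : Hom _ [:: s; s; t]) =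
    fork t s;
  fuse_bendl : forall s t, t = ~~ s ->
    comp (wh [:: s] [::] (fuse t s)) (wh [::] [:: t] (cup s t) : Hom _ [:: s; t; t]) =
    fork s t;
  fork_bend : forall s t, t = ~~ s ->
    comp (wh [:: s] [::] (cap s t)) (wh [::] [:: t] (fork s t) : Hom _ [:: s; s; t]) =
    fuse t s;
  fork_bendl : forall s t, t = ~~ s ->
    comp (wh [::] [:: t] (cap s t)) (wh [:: s] [::] (fork t s) : Hom _ [:: s; t; t]) =
    fuse s t;
  fork_cup : forall s t, t = ~~ s ->
    comp (wh [::] [:: s] (fork s t)) (cup t s) =
    comp (wh [:: s] [::] (fork s t)) (cup s t) :> Hom [::] [:: s; s; s]
}.
Arguments one {K qhalf} _ _.
Arguments wh {K qhalf} _ _ _ {a b a' b'} _.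
Arguments fuse {K qhalf} _ _ _.
Arguments fork {K qhalf} _ _ _.
Arguments cup {K qhalf} _ _ _.
Arguments cap {K qhalf} _ _ _.

Section LocalRelations.
Variables (K : fieldType) (qhalf : K) (C : calculus qhalf).
Local Notation Hom := (Hom C).
Local Notation one := (one C).
Local Notation wh := (wh C).
Local Notation fuse := (fuse C).
Local Notation fork := (fork C).
Local Notation cup := (cup C).
Local Notation cap := (cap C).
Local Notation qint := (qint qhalf).
Local Notation "g \circ f" := (comp g f).

Section Laws.
Context {a b c : seq sign}.
Implicit Types (f : Hom a b) (g : Hom b c).

Lemma compDr g f f' : g \circ (f + f') = g \circ f + g \circ f'.
Proof. by have := compPr g 1 f f'; rewrite !scale1r. Qed.
Lemma compDl f g g' : (g + g') \circ f = g \circ f + g' \circ f.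
Proof. by have := compPl f 1 g g'; rewrite !scale1r. Qed.
Lemma comp0r g : g \circ (0 : Hom a b) = 0.
Proof. by apply: (addrI (g \circ 0)); rewrite -compDr !addr0. Qed.
Lemma comp0l f : (0 : Hom b c) \circ f = 0.
Proof. by apply: (addrI (0 \circ f)); rewrite -compDl !addr0. Qed.
Lemma compZr g x f : g \circ (x *: f) = x *: (g \circ f).
Proof. by have := compPr g x f 0; rewrite comp0r !addr0. Qed.
Lemma compZl f x g : (x *: g) \circ f = x *: (g \circ f).
Proof. by have := compPl f x g 0; rewrite comp0l !addr0. Qed.
Lemma compNr g f : g \circ (- f) = - (g \circ f).
Proof. by rewrite -scaleN1r compZr scaleN1r. Qed.
Lemma compNl f g : (- g) \circ f = - (g \circ f).
Proof. by rewrite -scaleN1r compZl scaleN1r. Qed.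
Lemma comp_sumr g n (F : 'I_n -> Hom a b) :
  g \circ (\sum_i F i) = \sum_i g \circ F i.
Proof. by apply: (big_morph _ (compDr g) (comp0r g)). Qed.
Lemma comp_suml f n (F : 'I_n -> Hom b c) :
  (\sum_i F i) \circ f = \sum_i F i \circ f.
Proof. by apply: (big_morph (fun g => g \circ f) (compDl f) (comp0l f)). Qed.

Lemma whD l r a' b' f f' : wh l r (f + f') = wh l r f + wh l r f' :> Hom a' b'.
Proof. by have := @whP _ _ C l r a b a' b' 1 f f'; rewrite !scale1r. Qed.
Lemma wh_0 l r a' b' : wh l r (0 : Hom a b) = 0 :> Hom a' b'.
Proof. by apply: (addrI (wh l r (0 : Hom a b))); rewrite -whD !addr0. Qed.
Lemma whZ l r a' b' x f : wh l r (x *: f) = x *: wh l r f :> Hom a' b'.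
Proof. by have := @whP _ _ C l r a b a' b' x f 0; rewrite wh_0 !addr0. Qed.
Lemma whB l r a' b' f f' : wh l r (f - f') = wh l r f - wh l r f' :> Hom a' b'.
Proof. by rewrite whD -scaleN1r whZ scaleN1r. Qed.

Lemma wh_compE l r a' c' g f : a' = l ++ a ++ r -> c' = l ++ c ++ r ->
  wh l r (g \circ f) = (wh l r g : Hom (l ++ b ++ r) c') \circ
    (wh l r f : Hom a' (l ++ b ++ r)).
Proof. by move=> ea ec; apply: wh_comp. Qed.
End Laws.

Definition compE := (@compDr, @compNr, @compZr, @compDl, @compNl, @compZl, @compA).

Definition ladder s t : Hom [:: s; s] [:: s; s] := fork s t \circ fuse s t.

(* The webs [s t -> t s] and [t s -> s t] shaped like the letter H.           *)
Definition rung s t : Hom [:: s; t] [:: t; s] :=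
  wh [::] [:: s] (fuse s t) \circ
    (wh [:: s] [::] (fork s t) : Hom _ [:: s; s; s]).
Definition corung s t : Hom [:: t; s] [:: s; t] :=
  wh [:: s] [::] (fuse s t) \circ
    (wh [::] [:: s] (fork s t) : Hom _ [:: s; s; s]).

Lemma corung_rung s t : t = ~~ s ->
  corung s t \circ rung s t = one [:: s; t] + cup s t \circ cap s t.
Proof. exact: square. Qed.

(** Once the forks are written as bent fuses, both webs are [fuse s t] and [fuse t s] joined by a
    cup, at exchanged heights. Hence the square relation evaluates both composites of a rung and a
    corung. *)
Lemma rung_corung s t : t = ~~ s -> rung s t = corung t s.
Proof.
move=> e; rewrite /rung -[in LHS](fuse_bendl _ e) wh_compE //.
rewrite /corung -(fuse_bend _ e) wh_compE // !(wh_wh, compA) //=.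
by congr (_ \circ _); apply/esym/(wh_exchange (l := [::]) (m := [::]) (r := [::])).
Qed.

(** The bent strand turns the two vertices of the ladder into the corners of a 2-gon. *)
Lemma cap_ladder_cup s t : t = ~~ s ->
  wh [:: s] [::] (cap s t)
    \circ (wh [::] [:: t] (ladder s t) : Hom [:: s; s; t] [:: s; s; t])
    \circ wh [:: s] [::] (cup s t) = qint 2 *: one [:: s] :> Hom [:: s] [:: s].
Proof.
move=> e; have e' : s = ~~ t by rewrite e negbK.
rewrite /ladder wh_compE // compA fork_bend // -compA fuse_bend //.
exact: fuse_fork.
Qed.

Lemma cap_ladder_cupl s t : t = ~~ s ->
  wh [::] [:: t] (cap s t)
    \circ (wh [:: s] [::] (ladder t s) : Hom [:: s; t; t] [:: s; t; t])
    \circ wh [::] [:: t] (cup s t) = qint 2 *: one [:: t] :> Hom [:: t] [:: t].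
Proof.
move=> e; rewrite /ladder wh_compE // compA fork_bendl // -compA.
by rewrite fuse_bendl // fuse_fork.
Qed.

(** The cup and the cap close the two ladders up to a 4-gon. *)
Lemma cap_ladder2_cup s t : t = ~~ s ->
  wh [:: s] [:: t] (cap s t)
    \circ (wh [:: s; s] [::] (ladder t s) : Hom [:: s; s; t; t] [:: s; s; t; t])
    \circ (wh [::] [:: t; t] (ladder s t) : Hom [:: s; s; t; t] [:: s; s; t; t])
    \circ wh [:: s] [:: t] (cup s t) =
  one [:: s; t] + cup s t \circ cap s t :> Hom [:: s; t] [:: s; t].
Proof.
move=> e; have e' : s = ~~ t by rewrite e negbK.
rewrite -corung_rung // rung_corung //.
rewrite /corung -(fuse_bend _ e) -{1}(fork_bendl _ e) /ladder.
rewrite !wh_compE // !(wh_wh, compA) //=.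
congr (_ \circ _ \circ _); rewrite -!compA; congr (_ \circ (_ \circ _)).
exact: (wh_exchange (l := [::]) (m := [::]) (r := [::])).
Qed.

(** Both sides are the vertex with three legs pointing down: written as a fork with two caps, they
    differ only in the order of the caps. *)
Lemma cap_fuse s t : t = ~~ s ->
  cap s t \circ wh [:: s] [::] (fuse s t) =
  cap t s \circ wh [::] [:: s] (fuse s t) :> Hom [:: s; s; s] [::].
Proof.
move=> e; have e' : s = ~~ t by rewrite e negbK.
rewrite -{1}(fork_bend _ e') -(fork_bendl _ e) !wh_compE //.
rewrite !(wh_wh, compA) //=; congr (_ \circ _).
rewrite -[cap s t]wh_nil -[cap t s]wh_nil !wh_wh //.
by apply/esym/(wh_exchange (l := [::]) (m := [::]) (r := [::])).
Qed.

(** The 4-gon in [L1 L2 L1] resolves into [L1] and a web of two separate vertices, one with its legs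
    below and one with its legs above. [L2 L1 L2] gives [L2] and the same web. *)
Lemma ladder_braid s t : t = ~~ s ->
  let L1 := wh [::] [:: s] (ladder s t) : Hom [:: s; s; s] [:: s; s; s] in
  let L2 := wh [:: s] [::] (ladder s t) : Hom [:: s; s; s] [:: s; s; s] in
  L1 \circ L2 \circ L1 - L1 = L2 \circ L1 \circ L2 - L2.
Proof.
move=> e L1 L2; have e' : s = ~~ t by rewrite e negbK.
have -> : L1 \circ L2 \circ L1 = (wh [::] [:: s] (fork s t) : Hom [:: t; s] _)
    \circ (rung s t \circ corung s t) \circ wh [::] [:: s] (fuse s t).
  by rewrite /L1 /L2 /rung /corung /ladder !wh_compE // !compA.
have -> : L2 \circ L1 \circ L2 = (wh [:: s] [::] (fork s t) : Hom [:: s; t] _)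
    \circ (corung s t \circ rung s t) \circ wh [:: s] [::] (fuse s t).
  by rewrite /L1 /L2 /rung /corung /ladder !wh_compE // !compA.
have -> : rung s t \circ corung s t = one [:: t; s] + cup t s \circ cap t s.
  by rewrite rung_corung // -corung_rung // [rung t s]rung_corung.
rewrite corung_rung // !compE !comp1r fork_cup // -!compA.
by rewrite cap_fuse // /L1 /L2 /ladder !wh_compE // !(addrAC _ _ (- _)) !subrr.
Qed.

Lemma ladder_sqr s t : t = ~~ s ->
  ladder s t \circ ladder s t = qint 2 *: ladder s t.
Proof.
move=> e; rewrite /ladder -compA (compA (fuse s t)) fuse_fork //.
by rewrite compZl comp1l compZr.
Qed.
End LocalRelations.

(** * Wenzl's recursion in the Hecke algebra *)

Section Wenzl.
Variables (K : fieldType) (qhalf : K) (C : calculus qhalf).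
Local Notation Hom := (Hom C).
Local Notation one := (one C).
Local Notation "g \circ f" := (comp g f).
Local Notation qint := (qint qhalf).

(** The Hecke algebra in generators with [h^2 = [2] h]; N of them act on N + 1 strands. *)
Definition hecke a N (h : nat -> Hom a a) : Prop :=
  [/\ forall i, (i < N)%N -> h i \circ h i = qint 2 *: h i,
      forall i j, (i.+1 < j < N)%N -> h i \circ h j = h j \circ h i &
      forall i, (i.+1 < N)%N ->
        h i \circ h i.+1 \circ h i - h i = h i.+1 \circ h i \circ h i.+1 - h i.+1].

(** The projector on n strands involves [h 0, ..., h (n - 2)], whence the conditions [i.+1 < n]
    below. *)
Fixpoint wenzl a (h : nat -> Hom a a) n : Hom a a :=
  if n is n'.+1 then
    let p := wenzl h n' in
    if n' is m.+1 then p - (qint n' / qint n'.+1) *: (p \circ h m \circ p) else p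
  else one a.

Lemma wenzlSS a (h : nat -> Hom a a) n : wenzl h n.+2 =
  wenzl h n.+1 - (qint n.+1 / qint n.+2) *: (wenzl h n.+1 \circ h n \circ wenzl h n.+1).
Proof. by []. Qed.

Lemma wenzl_morph a b (phi : Hom a a -> Hom b b) h h' n :
  (forall f g x, phi (f - x *: g) = phi f - x *: phi g) ->
  phi (one a) = one b -> (forall f g, phi (g \circ f) = phi g \circ phi f) ->
  (forall i, (i.+1 < n)%N -> phi (h i) = h' i) -> phi (wenzl h n) = wenzl h' n.
Proof.
move=> phiB phi1 phiM; elim: n => [|[|n] IHn] hh' //.
rewrite !wenzlSS phiB !phiM (hh' n (ltnSn _)).
by rewrite IHn // => i lt_in; apply: hh'; apply: ltnW.
Qed.

(** Expanded, the projector is the identity plus a combination of nonempty products of generators,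
    each of which kills [z]. *)
Lemma wenzl_fix a b (h : nat -> Hom a a) n (z : Hom b a) :
  (forall i, (i.+1 < n)%N -> h i \circ z = 0) -> wenzl h n \circ z = z.
Proof.
elim: n => [|[|n] IHn] hz; rewrite ?comp1l //.
rewrite wenzlSS compDl compNl compZl -!compA.
rewrite IHn => [|i lt_in]; last exact/hz/ltnW.
by rewrite (hz n (ltnSn _)) comp0r scaler0 subr0.
Qed.

Lemma wenzl_fixr a b (h : nat -> Hom a a) n (z : Hom a b) :
  (forall i, (i.+1 < n)%N -> z \circ h i = 0) -> z \circ wenzl h n = z.
Proof.
elim: n => [|[|n] IHn] hz; rewrite ?comp1r //.
rewrite wenzlSS !compE IHn => [|i lt_in]; last exact/hz/ltnW.
by rewrite (hz n (ltnSn _)) comp0l scaler0 subr0.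
Qed.

(** Here [r] and [p] are consecutive projectors, [g] is the generator by which they differ and [h]
    the next one. In [h p h] the braid relation replaces [h g h] by [g h g - g + h], and composing
    with [p] leaves only the last term, as [g] and [p] annihilate each other. This lowers the
    eigenvalue from c to c - d. *)
Lemma wenzl_partial a (g h r p : Hom a a) c d :
  p = r - d *: (r \circ g \circ r) -> r \circ p = p -> p \circ r = p ->
  h \circ r = r \circ h -> g \circ p = 0 -> p \circ g = 0 ->
  h \circ h = c *: h -> h \circ g \circ h = g \circ h \circ g - g + h ->
  h \circ p \circ h \circ p = (c - d) *: (h \circ p) /\
  p \circ h \circ p \circ h = (c - d) *: (p \circ h).
Proof.
move=> pE rp pr hr gp pg hh braid.
have hph : h \circ p \circ h =
    c *: (r \circ h) - d *: (r \circ (g \circ h \circ g - g + h) \circ r).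
  rewrite -braid pE !compE hr -(compA r h h) hh compZr.
  by rewrite -(compA _ r h) -hr compA.
have rhp : r \circ h \circ p = h \circ p by rewrite -hr -compA rp.
have phr : p \circ h \circ r = p \circ h by rewrite -compA hr compA pr.
split.
  rewrite hph !compE -!(compA _ r p) rp -!(compA _ g p) gp !comp0r.
  by rewrite rhp oppr0 !add0r scalerBl.
rewrite -(compA p h p) -(compA p _ h) hph !compE pr pg !comp0l.
by rewrite oppr0 !add0r phr scalerBl.
Qed.

Section Hecke.
Hypothesis qint_neq0 : forall n, qint n.+1 != 0.
Variables (a : seq sign) (N : nat) (h : nat -> Hom a a).
Hypothesis hP : hecke N h.
Local Notation p := (wenzl h).

Lemma wenzl_comm n j : (n <= j < N)%N -> h j \circ p n = p n \circ h j.
Proof.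
have [_ hC _] := hP.
elim: n => [|[|n] IHn] /andP[le_nj lt_jN]; rewrite ?comp1l ?comp1r //.
have {}IHn : h j \circ p n.+1 = p n.+1 \circ h j by apply: IHn; rewrite ltnW.
rewrite wenzlSS !compE IHn -!compA -IHn; congr (_ - _ *: (_ \circ _)).
by rewrite !compA (hC n j) // le_nj.
Qed.

(** This equals [n+2]/[n+1], the inverse of the coefficient in the recursion, which makes [h n] kill
    the next projector. *)
Let step n := qint 2 - qint n / qint n.+1.

Let stepE n : qint n.+1 / qint n.+2 * step n = 1.
Proof.
rewrite /step; have -> : qint 2 - qint n / qint n.+1 = qint n.+2 / qint n.+1.
  by rewrite (qintSS qint_neq0 n) mulrBl mulfK.
by rewrite mulrA divfK // divff.
Qed.

Lemma wenzl_kill n i : (i.+1 < n <= N.+1)%N ->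
  h i \circ p n = 0 /\ p n \circ h i = 0.
Proof.
have [hh hC hbr] := hP.
have braid j : (j.+1 < N)%N -> h j.+1 \circ h j \circ h j.+1 =
    h j \circ h j.+1 \circ h j - h j + h j.+1.
  by move=> lt_jN; rewrite hbr // subrK.
elim: n i => [|[|n] IHn] i // /andP[lt_in le_nN].
have kill j : (j.+1 < n.+1)%N -> h j \circ p n.+1 = 0 /\ p n.+1 \circ h j = 0.
  by move=> lt_jn; apply: IHn; rewrite lt_jn ltnW.
have [hphp phph] : h n \circ p n.+1 \circ h n \circ p n.+1 = step n *: (h n \circ p n.+1)
    /\ p n.+1 \circ h n \circ p n.+1 \circ h n = step n *: (p n.+1 \circ h n).
  (* On one strand the projector is the identity, and [0] = 0 gives the eigenvalue [2]. *)
  case: n le_nN kill {IHn lt_in} => [|n] le_nN kill.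
    by rewrite /step qint0 mul0r subr0 !comp1l !comp1r hh.
  have [gp pg] := kill n (ltnSn _).
  apply: (@wenzl_partial _ (h n) _ (p n.+1)) => //.
  - by apply: wenzl_fix => j lt_jn; apply: (kill _ (ltnW _)).1.
  - by apply: wenzl_fixr => j lt_jn; apply: (kill _ (ltnW _)).2.
  - by apply: wenzl_comm; rewrite leqnn.
  - exact: hh.
  - exact: braid.
move: lt_in; rewrite ltnS leq_eqVlt => /orP[/eqP[->]|/kill[k1 k2]]; last first.
  rewrite wenzlSS !compE k1 k2 -(compA _ _ (h i)) k2 !comp0l comp0r.
  by rewrite scaler0 subr0.
rewrite wenzlSS !compE; split.
  by rewrite hphp scalerA stepE scale1r subrr.
by rewrite phph scalerA stepE scale1r subrr.
Qed.

Lemma wenzl_idem n : (n <= N.+1)%N -> p n \circ p n = p n.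
Proof.
move=> le_nN; apply: wenzl_fixr => i lt_in.
by apply: (wenzl_kill _).2; rewrite lt_in.
Qed.
End Hecke.

Lemma hecke_rev a N (h : nat -> Hom a a) :
  hecke N h -> hecke N (fun i => h (N.-1 - i)%N).
Proof.
case=> hh hC hbr; split=> [i lt_iN|i j /andP[lt_ij lt_jN]|i lt_iN].
- by apply: hh; lia.
- by apply/esym/hC; lia.
- have := hbr (N.-1 - i.+1)%N; have -> : (N.-1 - i.+1).+1 = (N.-1 - i)%N by lia.
  by move=> ->; [|lia].
Qed.

(* Both sides are the idempotent killed by all the [h i] and congruent to the
   identity modulo the ideal that these generate.                             *)
Lemma wenzl_rev a N (h : nat -> Hom a a) : (forall n, qint n.+1 != 0) ->
  hecke N h -> wenzl (fun i => h (N.-1 - i)%N) N.+1 = wenzl h N.+1.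
Proof.
move=> q0 hP; set h' := fun _ => _.
transitivity (wenzl h' N.+1 \circ wenzl h N.+1).
  apply/esym/wenzl_fixr => i lt_iN.
  have -> : h i = h' (N.-1 - i)%N by rewrite /h'; congr h; lia.
  by apply: (wenzl_kill q0 (hecke_rev hP) _).2; lia.
apply: wenzl_fix => i lt_iN.
by apply: (wenzl_kill q0 hP _).1; lia.
Qed.
End Wenzl.

(** * Clasps of strands of one sign *)

Lemma nseq_catC (x : sign) m n l :
  nseq m x ++ nseq n x ++ l = nseq (m + n) x ++ l.
Proof. by rewrite catA nseqD. Qed.

(* Proves equalities between words that are concatenations of powers of signs. *)
Ltac strands :=
  lazymatch goal with |- @eq (list _) _ _ => idtac end;
  rewrite ?subnn;
  repeat match goal with |- context [@nseq ?T 0 ?x] =>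
    change (@nseq T 0 x) with (@nil T) end;
  repeat match goal with |- context [@cons ?T ?x ?l] =>
    change (@cons T x l) with (@nseq T 1 x ++ l) end;
  rewrite ?(cats0, cat0s) -?catA ?cats0 -?nseqD ?nseq_catC -?nseqD;
  repeat first [reflexivity | congr (nseq _ _ ++ _) | congr nseq]; lia.

Lemma wh_eq (K : fieldType) (qhalf : K) (C : calculus qhalf) l l' r r' a b a' b'
  (f : Hom C a b) : l = l' -> r = r' -> wh C l r f = wh C l' r' f :> Hom C a' b'.
Proof. by move=> -> ->. Qed.

Section OneColour.
Variables (K : fieldType) (qhalf : K) (C : calculus qhalf).
Local Notation Hom := (Hom C).
Local Notation one := (one C).
Local Notation wh := (wh C).
Local Notation qint := (qint qhalf).
Local Notation "g \circ f" := (comp g f).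
Hypothesis qint_neq0 : forall n, qint n.+1 != 0.
Variables (s t : sign).
Hypothesis st : t = ~~ s.
Local Notation strand n := (nseq n s).

Definition rungs n i : Hom (strand n) (strand n) :=
  wh (strand i) (strand (n - i.+2)) (ladder C s t).

Lemma rungs_hecke n : hecke n.-1 (rungs n).
Proof.
rewrite /rungs; split=> [i lt_in|i j lt_ij|i lt_in].
- by rewrite -wh_comp ?ladder_sqr ?whZ //; strands.
- apply/esym/(wh_exchange (m := strand (j - i.+2))); strands.
- have E (f := ladder C s t) : wh (strand i) (strand (n - i.+2)) f =
    wh (strand i) (strand (n - i.+3)) (wh [::] [:: s] f : Hom [:: s; s; s] [:: s; s; s])
    :> Hom (strand n) (strand n).
    rewrite wh_wh //; try strands.
    by apply: wh_eq; strands.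
  have E' (f := ladder C s t) : wh (strand i.+1) (strand (n - i.+3)) f =
    wh (strand i) (strand (n - i.+3)) (wh [:: s] [::] f : Hom [:: s; s; s] [:: s; s; s])
    :> Hom (strand n) (strand n).
    rewrite wh_wh //; try strands.
    by apply: wh_eq; strands.
  rewrite E E' -!wh_comp -?whB ?ladder_braid //; strands.
Qed.

Definition jw n := wenzl (rungs n) n.

Lemma jw_right_wenzl n k : (k <= n)%N ->
  wh [::] [:: s] (wenzl (rungs n) k) = wenzl (rungs n.+1) k.
Proof.
move=> le_kn; apply: wenzl_morph => [f g x||f g|i lt_ik].
- by rewrite whB whZ.
- by apply: wh_one; strands.
- by apply: wh_comp; strands.
- rewrite /rungs wh_wh; try strands.
  by apply: wh_eq; strands.
Qed.

Lemma jw_idem n : jw n \circ jw n = jw n.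
Proof.
case: n => [|n]; first exact: comp1l.
exact (wenzl_idem qint_neq0 (rungs_hecke n.+1) (leqnn _)).
Qed.

Lemma jw_kill n i : (i.+1 < n)%N -> rungs n i \circ jw n = 0 /\ jw n \circ rungs n i = 0.
Proof.
by move=> lt_in; apply: (wenzl_kill qint_neq0 (rungs_hecke n)); lia.
Qed.

(** For [n = 0] no ladder fits on the single strand; [0] = 0 discards the junk value of [rungs]. *)
Lemma jw_right n : jw n.+1 = wh [::] [:: s] (jw n) - (qint n / qint n.+1) *:
  (wh [::] [:: s] (jw n) \circ rungs n.+1 n.-1 \circ wh [::] [:: s] (jw n)).
Proof.
rewrite jw_right_wenzl //; case: n => [|n]; last exact: wenzlSS.
by rewrite qint0 mul0r scale0r subr0.
Qed.

Lemma jw_rev n : jw n = wenzl (fun i => rungs n (n.-2 - i)) n.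
Proof. by case: n => [|n] //; rewrite (wenzl_rev qint_neq0 (rungs_hecke n.+1)). Qed.

(** A new strand on the left renumbers the ladders counted from the left but not those counted from
    the right, so the reversed form of the projector is used. *)
Lemma jw_left_wenzl n : wh [:: s] [::] (jw n) = wenzl (fun i => rungs n.+1 (n.-1 - i)) n.
Proof.
rewrite jw_rev; apply: wenzl_morph => [f g x||f g|i lt_ik].
- by rewrite whB whZ.
- by apply: wh_one; strands.
- by apply: wh_comp; strands.
- rewrite /rungs wh_wh; try strands.
  by apply: wh_eq; strands.
Qed.

Lemma jw_left n : jw n.+1 = wh [:: s] [::] (jw n) - (qint n / qint n.+1) *:
  (wh [:: s] [::] (jw n) \circ rungs n.+1 0 \circ wh [:: s] [::] (jw n)).
Proof.
rewrite jw_left_wenzl jw_rev; case: n => [|n]; last by rewrite wenzlSS subnn.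
by rewrite qint0 mul0r scale0r subr0.
Qed.

Lemma jw_absorb_right n : wh [::] [:: s] (jw n) \circ jw n.+1 = jw n.+1 /\
  jw n.+1 \circ wh [::] [:: s] (jw n) = jw n.+1.
Proof.
rewrite jw_right_wenzl //; split; [apply: wenzl_fix | apply: wenzl_fixr] => i lt_in.
  by apply: (jw_kill _).1; lia.
by apply: (jw_kill _).2; lia.
Qed.

Lemma jw_absorb_left n : wh [:: s] [::] (jw n) \circ jw n.+1 = jw n.+1 /\
  jw n.+1 \circ wh [:: s] [::] (jw n) = jw n.+1.
Proof.
rewrite jw_left_wenzl //; split; [apply: wenzl_fix | apply: wenzl_fixr] => i lt_in.
  by apply: (jw_kill _).1; lia.
by apply: (jw_kill _).2; lia.
Qed.
End OneColour.

(** * Clasps of strands of both signs *)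

(** The product of two recursions, one for each sign. Operators on strands of different signs
    commute, so every term can be put between two copies of [I]. *)
Lemma comp_expand (K : fieldType) (qhalf : K) (C : calculus qhalf) a
    (A B R T : Hom C a a) c d :
  comp A A = A -> comp B B = B -> comp B A = comp A B ->
  comp B R = comp R B -> comp T A = comp A T ->
  let I := comp A B in
  comp (A - c *: comp (comp A R) A) (B - d *: comp (comp B T) B) =
  I - c *: comp (comp I R) I - d *: comp (comp I T) I
    + (c * d) *: comp (comp (comp I R) T) I.
Proof.
move=> AA BB BA BR TA I.
have -> : comp (comp I R) I = comp (comp (comp A R) A) B.
  by rewrite /I !compA -(compA A B R) BR compA -(compA _ B A) BA !compA -(compA _ B B) BB.
have -> : comp (comp I T) I = comp (comp (comp A B) T) B.
  by rewrite /I !compA -(compA _ T A) TA compA -(compA A B A) BA compA AA.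
have -> : comp (comp (comp I R) T) I = comp (comp (comp (comp (comp A R) A) B) T) B.
  rewrite /I !compA -(compA A B R) BR compA -(compA _ T A) TA compA.
  by rewrite -(compA _ B A) BA !compA.
by rewrite !compE scalerDr scalerN scalerA opprD opprK [d * c]mulrC addrA.
Qed.

Section TwoColours.
Variables (K : fieldType) (qhalf : K) (C : calculus qhalf).
Local Notation Hom := (Hom C).
Local Notation one := (one C).
Local Notation wh := (wh C).
Local Notation qint := (qint qhalf).
Local Notation qfact := (qfact qhalf).
Local Notation qbinom := (qbinom qhalf).
Local Notation "g \circ f" := (comp g f).
Hypothesis qint_neq0 : forall n, qint n.+1 != 0.
Variables (s t : sign).
Hypothesis st : t = ~~ s.
Let ts : s = ~~ t. Proof. by rewrite st negbK. Qed.
Local Notation Z k l := (nseq k s ++ nseq l t).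
Local Notation jws := (jw C s t).
Local Notation jwt := (jw C t s).

Definition lft k l (x : Hom (nseq k s) (nseq k s)) : Hom (Z k l) (Z k l) :=
  wh [::] (nseq l t) x.
Definition rgt k l (y : Hom (nseq l t) (nseq l t)) : Hom (Z k l) (Z k l) :=
  wh (nseq k s) [::] y.

Lemma lft_comp k l x y : lft l (x \circ y) = @lft k l x \circ lft l y.
Proof. by apply: wh_comp; strands. Qed.
Lemma rgt_comp k l x y : rgt k (x \circ y) = @rgt k l x \circ rgt k y.
Proof. by apply: wh_comp; strands. Qed.
Lemma rgt_one k l : rgt k (one (nseq l t)) = one (Z k l).
Proof. by apply: wh_one; strands. Qed.
Lemma lft_rgt k l x y : @rgt k l y \circ lft l x = lft l x \circ rgt k y.
Proof. by apply: (wh_exchange (l := [::]) (m := [::]) (r := [::])); strands. Qed.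

(* Locked, since [compA] would otherwise match through it.                    *)
Definition jw2 k l : Hom (Z k l) (Z k l) :=
  locked (lft l (jws k) \circ rgt k (jwt l)).
Lemma jw2E k l : jw2 k l = lft l (jws k) \circ rgt k (jwt l).
Proof. by rewrite /jw2 -lock. Qed.

Lemma jw2_idem k l : jw2 k l \circ jw2 k l = jw2 k l.
Proof.
rewrite jw2E compA -(compA _ (rgt _ _) (lft _ _)) lft_rgt compA -lft_comp jw_idem //.
by rewrite -compA -rgt_comp jw_idem.
Qed.

Definition capw k l : Hom (Z k.+1 l.+1) (Z k l) :=
  wh (nseq k s) (nseq l t) (cap C s t).
Definition cupw k l : Hom (Z k l) (Z k.+1 l.+1) :=
  wh (nseq k s) (nseq l t) (cup C s t).

Lemma capw_lft k l x :
  capw k l \circ lft l.+1 (wh [::] [:: s] x) = lft l x \circ capw k l.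
Proof.
rewrite /lft wh_wh; try strands.
by apply: (wh_exchange (l := [::]) (m := [::])); strands.
Qed.

Lemma cupw_lft k l x :
  lft l.+1 (wh [::] [:: s] x) \circ cupw k l = cupw k l \circ lft l x.
Proof.
rewrite /lft wh_wh; try strands.
by apply/esym/(wh_exchange (l := [::]) (m := [::])); strands.
Qed.

Lemma capw_rgt k l y :
  capw k l \circ rgt k.+1 (wh [:: t] [::] y) = rgt k y \circ capw k l.
Proof.
rewrite /rgt wh_wh; try strands.
by apply/esym/(wh_exchange (m := [::]) (r := [::])); strands.
Qed.

Lemma cupw_rgt k l y :
  rgt k.+1 (wh [:: t] [::] y) \circ cupw k l = cupw k l \circ rgt k y.
Proof.
rewrite /rgt wh_wh; try strands.
by apply: (wh_exchange (m := [::]) (r := [::])); strands.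
Qed.

(** The clasps on all strands but the two that meet the cap; they slide through [capw] and
    [cupw]. *)
Definition inner k l : Hom (Z k.+1 l.+1) (Z k.+1 l.+1) :=
  lft l.+1 (wh [::] [:: s] (jws k)) \circ rgt k.+1 (wh [:: t] [::] (jwt l)).

Lemma capw_inner k l : capw k l \circ inner k l = jw2 k l \circ capw k l.
Proof. by rewrite jw2E /inner compA capw_lft -compA capw_rgt compA. Qed.

Lemma inner_cupw k l : inner k l \circ cupw k l = cupw k l \circ jw2 k l.
Proof. by rewrite jw2E /inner -compA cupw_rgt compA cupw_lft compA. Qed.

Lemma inner_jw2 k l : inner k l \circ jw2 k.+1 l.+1 = jw2 k.+1 l.+1.
Proof.
rewrite jw2E /inner compA -(compA _ (rgt _ _) (lft _ _)) lft_rgt compA -lft_comp.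
rewrite (jw_absorb_right C qint_neq0 st k).1 -compA -rgt_comp.
by rewrite (jw_absorb_left C qint_neq0 ts l).1.
Qed.

Lemma jw2_inner k l : jw2 k.+1 l.+1 \circ inner k l = jw2 k.+1 l.+1.
Proof.
rewrite jw2E /inner compA -(compA _ (rgt _ _) (lft _ _)) lft_rgt compA -lft_comp.
rewrite (jw_absorb_right C qint_neq0 st k).2 -compA -rgt_comp.
by rewrite (jw_absorb_left C qint_neq0 ts l).2.
Qed.

Lemma jw2_cupw k l : jw2 k.+1 l.+1 \circ cupw k l \circ jw2 k l =
  jw2 k.+1 l.+1 \circ cupw k l.
Proof. by rewrite -compA -inner_cupw compA jw2_inner. Qed.

Lemma capw_jw2 k l : jw2 k l \circ capw k l \circ jw2 k.+1 l.+1 =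
  capw k l \circ jw2 k.+1 l.+1.
Proof. by rewrite -capw_inner -compA inner_jw2. Qed.

Definition capcup k l : Hom (Z k l) (Z k l) :=
  match k, l with
  | k'.+1, l'.+1 => cupw k' l' \circ capw k' l'
  | _, _ => 0
  end.

Lemma capw_cupw k l : capw k l \circ cupw k l = qint 3 *: one (Z k l).
Proof.
rewrite -wh_comp; try strands.
by rewrite cap_cup // whZ wh_one //; strands.
Qed.

Local Notation rs k := (lft _ (rungs C s t k.+1 k.-1)).
Local Notation rt l := (rgt _ (rungs C t s l.+1 0)).

Lemma capw_rs_cupw k l :
  capw k.+1 l \circ rs k.+1 \circ cupw k.+1 l = qint 2 *: one (Z k.+1 l).
Proof.
have e1 : wh [::] (nseq l.+1 t) (rungs C s t k.+2 k) = wh (nseq k s) (nseq l t)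
    (wh [::] [:: t] (ladder C s t) : Hom [:: s; s; t] [:: s; s; t])
    :> Hom (Z k.+2 l.+1) (Z k.+2 l.+1).
  rewrite /rungs !wh_wh; try strands.
  by apply: wh_eq; strands.
have e2 : capw k.+1 l = wh (nseq k s) (nseq l t)
    (wh [:: s] [::] (cap C s t) : Hom [:: s; s; t] [:: s]).
  by rewrite wh_wh; [apply: wh_eq|..]; strands.
have e3 : cupw k.+1 l = wh (nseq k s) (nseq l t)
    (wh [:: s] [::] (cup C s t) : Hom [:: s] [:: s; s; t]).
  by rewrite wh_wh; [apply: wh_eq|..]; strands.
rewrite /lft e1 e2 e3 -!wh_comp; try strands.
by rewrite cap_ladder_cup // whZ wh_one //; strands.
Qed.

Lemma capw_rt_cupw k l :
  capw k l.+1 \circ rt l.+1 \circ cupw k l.+1 = qint 2 *: one (Z k l.+1).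
Proof.
have e1 : wh (nseq k.+1 s) [::] (rungs C t s l.+2 0) = wh (nseq k s) (nseq l t)
    (wh [:: s] [::] (ladder C t s) : Hom [:: s; t; t] [:: s; t; t])
    :> Hom (Z k.+1 l.+2) (Z k.+1 l.+2).
  rewrite /rungs !wh_wh; try strands.
  by apply: wh_eq; strands.
have e2 : capw k l.+1 = wh (nseq k s) (nseq l t)
    (wh [::] [:: t] (cap C s t) : Hom [:: s; t; t] [:: t]).
  by rewrite wh_wh; [apply: wh_eq|..]; strands.
have e3 : cupw k l.+1 = wh (nseq k s) (nseq l t)
    (wh [::] [:: t] (cup C s t) : Hom [:: t] [:: s; t; t]).
  by rewrite wh_wh; [apply: wh_eq|..]; strands.
rewrite /rgt e1 e2 e3 -!wh_comp; try strands.
by rewrite cap_ladder_cupl // whZ wh_one //; strands.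
Qed.

Lemma capw_rst_cupw k l :
  capw k.+1 l.+1 \circ rs k.+1 \circ rt l.+1 \circ cupw k.+1 l.+1 =
  one (Z k.+1 l.+1) + capcup k.+1 l.+1.
Proof.
rewrite -(compA _ (lft _ _)) -lft_rgt !compA.
have e1 : wh [::] (nseq l.+2 t) (rungs C s t k.+2 k) = wh (nseq k s) (nseq l t)
    (wh [::] [:: t; t] (ladder C s t) : Hom [:: s; s; t; t] [:: s; s; t; t])
    :> Hom (Z k.+2 l.+2) (Z k.+2 l.+2).
  rewrite /rungs !wh_wh; try strands.
  by apply: wh_eq; strands.
have e2 : wh (nseq k.+2 s) [::] (rungs C t s l.+2 0) = wh (nseq k s) (nseq l t)
    (wh [:: s; s] [::] (ladder C t s) : Hom [:: s; s; t; t] [:: s; s; t; t])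
    :> Hom (Z k.+2 l.+2) (Z k.+2 l.+2).
  rewrite /rungs !wh_wh; try strands.
  by apply: wh_eq; strands.
have e3 : capw k.+1 l.+1 = wh (nseq k s) (nseq l t)
    (wh [:: s] [:: t] (cap C s t) : Hom [:: s; s; t; t] [:: s; t]).
  by rewrite wh_wh; [apply: wh_eq|..]; strands.
have e4 : cupw k.+1 l.+1 = wh (nseq k s) (nseq l t)
    (wh [:: s] [:: t] (cup C s t) : Hom [:: s; t] [:: s; s; t; t]).
  by rewrite wh_wh; [apply: wh_eq|..]; strands.
rewrite /lft /rgt e1 e2 e3 e4 -!wh_comp; try strands.
rewrite cap_ladder2_cup // whD; congr (_ + _).
  by apply: wh_one; strands.
by apply: wh_comp; strands.
Qed.

(** Expanding both clasps next to the cap gives four terms, which close up to a loop, a 2-gon for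
    either sign and a 4-gon. The identity part of the 4-gon joins the first coefficient; its other
    part is the second term. *)
Lemma capw_jw2_cupw k l :
  capw k l \circ jw2 k.+1 l.+1 \circ cupw k l =
  (qint (k + l + 3) / (qint k.+1 * qint l.+1)) *: jw2 k l +
  (qint k * qint l / (qint k.+1 * qint l.+1)) *:
    (jw2 k l \circ capcup k l \circ jw2 k l).
Proof.
set c := qint k / qint k.+1; set d := qint l / qint l.+1.
have -> : jw2 k.+1 l.+1 = inner k l
    - c *: (inner k l \circ rs k \circ inner k l)
    - d *: (inner k l \circ rt l \circ inner k l)
    + (c * d) *: (inner k l \circ rs k \circ rt l \circ inner k l).
  rewrite jw2E jw_right // jw_left //.
  rewrite /lft whB whZ -/c -!/(lft _ _) !lft_comp.
  rewrite /rgt whB whZ -/d -!/(rgt _ _) !rgt_comp.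
  apply: comp_expand; rewrite -?lft_rgt // -?lft_comp -?rgt_comp.
    rewrite -wh_comp ?jw_idem //; strands.
  rewrite -wh_comp ?jw_idem //; strands.
have f1 := capw_cupw k l.
(* For [k = 0] there is no ladder, but then [c = 0]; likewise for [l] and [d] below. *)
have f2 : c *: (capw k l \circ rs k \circ cupw k l) = (c * qint 2) *: one (Z k l).
  rewrite {}/c {}/d; case: k {f1} => [|k'].
    by rewrite qint0 !mul0r !scale0r.
  by rewrite capw_rs_cupw scalerA.
have f3 : d *: (capw k l \circ rt l \circ cupw k l) = (d * qint 2) *: one (Z k l).
  rewrite {}/c {}/d in f2 *; case: l {f1 f2} => [|l'].
    by rewrite qint0 !mul0r !scale0r.
  by rewrite capw_rt_cupw scalerA.
have f4 : (c * d) *: (capw k l \circ rs k \circ rt l \circ cupw k l) =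
    (c * d) *: (one (Z k l) + capcup k l).
  rewrite {}/c {}/d in f2 f3 *; case: k {f1 f2 f3} => [|k'].
    by rewrite qint0 !mul0r !scale0r.
  case: l => [|l']; first by rewrite qint0 !(mul0r, mulr0) !scale0r.
  by rewrite capw_rst_cupw.
move: (capw_inner k l) (inner_cupw k l) (jw2_idem k l).
move: (inner k l) (jw2 k l) (lft _ _) (rgt _ _) f2 f3 f4 => I p R T f2 f3 f4 cI Ic pp.
have {}f2 : c *: (p \circ capw k l \circ R \circ cupw k l \circ p) = (c * qint 2) *: p.
  by rewrite -!(compA p) -compZr -compZl f2 compZl compZr comp1l pp.
have {}f3 : d *: (p \circ capw k l \circ T \circ cupw k l \circ p) = (d * qint 2) *: p.
  by rewrite -!(compA p) -compZr -compZl f3 compZl compZr comp1l pp.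
have {}f4 : (c * d) *: (p \circ capw k l \circ R \circ T \circ cupw k l \circ p) =
    (c * d) *: p + (c * d) *: (p \circ capcup k l \circ p).
  rewrite -!(compA p) -compZr -compZl f4 compZl compZr compDl comp1l compDr pp.
  by rewrite scalerDr compA.
have {}f1 : p \circ capw k l \circ cupw k l = qint 3 *: p.
  by rewrite -compA f1 compZr comp1r.
have E : qint k * qint l / (qint k.+1 * qint l.+1) = c * d.
  by rewrite /c /d mulf_div.
(* The sum is ([2] - c)([2] - d) - 1, where [2] - c = [k+2]/[k+1] and [2] - d = [l+2]/[l+1]. *)
have E' : qint 3 - c * qint 2 - d * qint 2 + c * d =
    qint (k + l + 3) / (qint k.+1 * qint l.+1).
  have : qint (k + l + 3) = qint k.+2 * qint l.+2 - qint k.+1 * qint l.+1.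
    by rewrite (qint_mulS qint_neq0 k.+1) addrC addKr; congr qint; lia.
  move=> ->; rewrite (qintSS qint_neq0 k) (qintSS qint_neq0 l) qint3 // /c /d.
  by field; rewrite !qint_neq0.
rewrite !compE cI.
rewrite -!(compA _ I) Ic !compA f1 f2 f3 f4 E -E' !addrA.
by rewrite -!scalerBl -scalerDl.
Qed.

(* The clasped web with [j] nested caps below [j] nested cups.                *)
Fixpoint turnback j k l : Hom (Z k l) (Z k l) :=
  match j with
  | 0 => jw2 k l
  | j'.+1 =>
      match k, l return Hom (Z k l) (Z k l) with
      | k'.+1, l'.+1 => jw2 k'.+1 l'.+1 \circ cupw k' l' \circ turnback j' k' l'
                          \circ capw k' l' \circ jw2 k'.+1 l'.+1
      | _, _ => 0
      end
  end.

Lemma turnbackSSS j k l : turnback j.+1 k.+1 l.+1 =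
  jw2 k.+1 l.+1 \circ cupw k l \circ turnback j k l \circ capw k l \circ jw2 k.+1 l.+1.
Proof. by []. Qed.

Lemma turnback_eq0 j k l : (minn k l < j)%N -> turnback j k l = 0.
Proof.
elim: j k l => [|j IHj] [|k] [|l] //; rewrite minnSS ltnS => /IHj e.
by rewrite turnbackSSS e comp0r !comp0l.
Qed.

Lemma jw2_turnback j k l : jw2 k l \circ turnback j k l = turnback j k l.
Proof.
case: j => [|j]; first exact: jw2_idem.
case: k l => [|k] [|l]; try by rewrite turnback_eq0 ?comp0r // ?minn0.
by rewrite turnbackSSS !compA jw2_idem.
Qed.

Lemma turnback_jw2 j k l : turnback j k l \circ jw2 k l = turnback j k l.
Proof.
case: j => [|j]; first exact: jw2_idem.
case: k l => [|k] [|l]; try by rewrite turnback_eq0 ?comp0l // ?minn0.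
by rewrite turnbackSSS -(compA _ (jw2 _ _) (jw2 _ _)) jw2_idem.
Qed.

Lemma turnback1 k l : turnback 1 k l = jw2 k l \circ capcup k l \circ jw2 k l.
Proof.
case: k l => [|k] [|l]; try by rewrite turnback_eq0 ?comp0r ?comp0l // ?minn0.
by rewrite turnbackSSS jw2_cupw !compA.
Qed.

(** The extra turnback produced by [capw_jw2_cupw] meets the outer cup of [turnback j.+1] and
    encloses the same operator with one strand of each sign less, which is the induction
    hypothesis. *)
Lemma capw_cupw_turnback j k l : (j <= minn k l)%N ->
  capw k l \circ jw2 k.+1 l.+1 \circ cupw k l \circ turnback j k l =
  (qint j.+1 * qint (k + l + 3 - j) / (qint k.+1 * qint l.+1)) *: turnback j k l +
  (qint (k - j) * qint (l - j) / (qint k.+1 * qint l.+1)) *: turnback j.+1 k l.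
Proof.
elim: j k l => [|j IHj] k l.
  rewrite capw_jw2_cupw -turnback1 qint1 // mul1r !subn0 => _.
  by rewrite compDl !compZl turnback_jw2 jw2_idem.
case: k l => [|k] [|l]; rewrite ?minn0 ?min0n ?minnSS ?ltn0 // ltnS => le_j.
rewrite capw_jw2_cupw compDl !compZl jw2_turnback -turnback1.
have -> : turnback 1 k.+1 l.+1 \circ turnback j.+1 k.+1 l.+1 =
    jw2 k.+1 l.+1 \circ cupw k l \circ
      (capw k l \circ jw2 k.+1 l.+1 \circ cupw k l \circ turnback j k l)
      \circ capw k l \circ jw2 k.+1 l.+1.
  rewrite !turnbackSSS jw2_cupw !compA -(compA _ (jw2 _ _) (jw2 _ _)) jw2_idem.
  by rewrite -(compA _ (capw _ _) (jw2 _ _)).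
rewrite IHj // compDr !compZr !compDl !compZl -!turnbackSSS.
rewrite scalerDr !scalerA addrA -scalerDl; congr (_ *: _ + _ *: _).
  have -> : (k.+1 + l.+1 + 3 - j.+1 = (k + l + 3 - j).+1)%N by lia.
  have -> : (k.+1 + l.+1 + 3 = (j.+1 + (k + l + 3 - j)).+1)%N by lia.
  by rewrite (qint_mulS qint_neq0 j.+1); field; rewrite !qint_neq0.
by rewrite !subSS; field; rewrite !qint_neq0.
Qed.

Definition coef j k l := qbinom k j * qbinom l j / qbinom (k + l + 1) j.

Lemma qfactS n : qfact n.+1 = qfact n * qint n.+1.
Proof. exact: big_ord_recr. Qed.

Lemma qfact_neq0 n : qfact n != 0.
Proof.
elim: n => [|n IHn]; first by rewrite /qfact big_ord0 oner_eq0.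
by rewrite qfactS mulf_neq0.
Qed.

Lemma qbinomS n j : (j < n)%N -> qbinom n j.+1 = qbinom n j * qint (n - j) / qint j.+1.
Proof.
move=> lt_jn; rewrite /qbinom qfactS -(subnSK lt_jn) qfactS.
by field; rewrite !qint_neq0 !qfact_neq0.
Qed.

Lemma qbinom_neq0 n j : qbinom n j != 0.
Proof. by rewrite mulf_neq0 ?invr_eq0 ?mulf_neq0 ?qfact_neq0. Qed.

Lemma coef0 k l : coef 0 k l = 1.
Proof.
have q0 n : qbinom n 0 = 1.
  by rewrite /qbinom subn0 {2}/qfact big_ord0 mul1r divff ?qfact_neq0.
by rewrite /coef !q0 mul1r divr1.
Qed.

Lemma coefS j k l : (j <= minn k l)%N ->
  coef j.+1 k.+1 l.+1 * (qint j.+1 * qint (k + l + 3 - j)) =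
  coef j k.+1 l.+1 * (qint (k.+1 - j) * qint (l.+1 - j)).
Proof.
move=> le_j; rewrite /coef !qbinomS; try lia.
have -> : (k.+1 + l.+1 + 1 - j = (k + l + 2 - j).+1)%N by lia.
have -> : (k + l + 3 - j = (k + l + 2 - j).+1)%N by lia.
by field; rewrite !qint_neq0 qbinom_neq0.
Qed.

(** The coefficients are those of the clasp of s^(k+1) t^(l+1), shifted by one index: between a cup
    and a cap this becomes, up to sign, the sum defining that clasp without its first term. *)
Definition loopinv k l : Hom (Z k l) (Z k l) :=
  \sum_(j < (minn k l).+1) ((-1) ^+ j * coef j.+1 k.+1 l.+1) *: turnback j k l.

Lemma loopinvP k l :
  capw k l \circ jw2 k.+1 l.+1 \circ cupw k l \circ loopinv k l = jw2 k l.
Proof.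
(* Up to sign, the j-th summand contributes [a j] to [turnback j] and, by [coefS], [a j.+1] to
   [turnback j.+1]. What remains is [a 0 = 1] and a web with too many turnbacks, which is 0. *)
pose a j := coef j k.+1 l.+1 * (qint (k.+1 - j) * qint (l.+1 - j)) /
  (qint k.+1 * qint l.+1).
have tele n : \sum_(j < n) (-1) ^+ j *:
    (a j *: turnback j k l + a j.+1 *: turnback j.+1 k l) =
    jw2 k l + (-1) ^+ n.+1 *: (a n *: turnback n k l).
  elim: n => [|n IHn].
    rewrite big_ord0 /a coef0 mul1r !subn0.
    rewrite divff; last by apply: mulf_neq0; apply: qint_neq0.
    by rewrite expr1 scale1r scaleN1r subrr.
  rewrite big_ord_recr /= IHn scalerDr -addrA; congr (_ + _).
  by rewrite addrA exprS mulN1r scaleNr addNr add0r exprS mulN1r exprS mulN1r opprK.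
rewrite /loopinv comp_sumr (eq_bigr (fun j : 'I_(minn k l).+1 => (-1) ^+ j *:
    (a j *: turnback j k l + a j.+1 *: turnback j.+1 k l))); last first.
  move=> j _; have le_j : (j <= minn k l)%N by rewrite -ltnS.
  rewrite compZr capw_cupw_turnback // -[LHS]scalerA; congr (_ *: _).
  rewrite scalerDr !scalerA; congr (_ *: _ + _ *: _).
    by rewrite mulrA coefS.
  by rewrite /a !subSS !mulrA.
rewrite tele turnback_eq0 ?scaler0 ?addr0 //.
Qed.

Definition clasp2 k l : Hom (Z k l) (Z k l) :=
  \sum_(j < (minn k l).+1) ((-1) ^+ j * coef j k l) *: turnback j k l.

Lemma clasp2E k l : clasp2 k.+1 l.+1 = jw2 k.+1 l.+1 -
  jw2 k.+1 l.+1 \circ cupw k l \circ loopinv k l \circ (capw k l \circ jw2 k.+1 l.+1).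
Proof.
rewrite /clasp2 minnSS big_ord_recl coef0 expr0 mul1r scale1r; congr (_ + _).
rewrite /loopinv comp_sumr comp_suml -sumrN; apply: eq_bigr => j _.
rewrite lift0 exprS mulN1r mulNr scaleNr turnbackSSS compZr compZl !compA.
by [].
Qed.

Definition capk k l : Hom (Z k.+1 l.+1) (Z k l) := capw k l \circ jw2 k.+1 l.+1.
Definition cupk k l : Hom (Z k l) (Z k.+1 l.+1) :=
  jw2 k.+1 l.+1 \circ cupw k l \circ loopinv k l.

Lemma capk_cupk k l : capk k l \circ cupk k l = jw2 k l.
Proof.
rewrite /capk /cupk !compA -(compA _ (jw2 _ _) (jw2 _ _)) jw2_idem.
exact: loopinvP.
Qed.

Lemma cupk_capk k l : clasp2 k.+1 l.+1 + cupk k l \circ capk k l = jw2 k.+1 l.+1.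
Proof. by rewrite clasp2E subrK. Qed.

Lemma capk_jw2 k l : jw2 k l \circ capk k l \circ jw2 k.+1 l.+1 = capk k l.
Proof. by rewrite /capk compA capw_jw2 -compA jw2_idem. Qed.

(** Turnbacks without intermediate clasps, as in the definition of [clasp]; those in [turnback] are
    absorbed by the outer ones. *)
Fixpoint nested j k l : Hom (Z k l) (Z k l) :=
  match j with
  | 0 => one (Z k l)
  | j'.+1 =>
      match k, l return Hom (Z k l) (Z k l) with
      | k'.+1, l'.+1 => cupw k' l' \circ nested j' k' l' \circ capw k' l'
      | _, _ => 0
      end
  end.

Lemma turnbackE j k l : (j <= minn k l)%N ->
  turnback j k l = jw2 k l \circ nested j k l \circ jw2 k l.
Proof.
elim: j k l => [|j IHj] k l; first by rewrite comp1r jw2_idem.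
case: k l => [|k] [|l]; rewrite ?minn0 ?min0n ?minnSS ?ltn0 // ltnS => le_j.
rewrite turnbackSSS IHj // [nested j.+1 _ _]/(_ \circ _ \circ _) !compA jw2_cupw.
by rewrite -!compA (compA (jw2 k l) (capw k l)) capw_jw2.
Qed.

(** * Splitting off a vertex *)

Definition fusew k : Hom (nseq k.+2 s) (Z k 1) := wh (nseq k s) [::] (fuse C s t).
Definition forkw k : Hom (Z k 1) (nseq k.+2 s) := wh (nseq k s) [::] (fork C s t).
Definition jwr k : Hom (nseq k.+2 s) (nseq k.+2 s) := wh [::] [:: s] (jws k.+1).

Lemma forkw_fusew k : forkw k \circ fusew k = rungs C s t k.+2 k.
Proof. by rewrite /rungs subnn /ladder -wh_comp //; strands. Qed.

Lemma fusew_forkw k : fusew k \circ forkw k = qint 2 *: one (Z k 1).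
Proof.
rewrite -wh_comp; try strands.
by rewrite fuse_fork // whZ wh_one //; strands.
Qed.

Lemma fusew_lft k x : fusew k \circ wh [::] [:: s; s] x = lft 1 x \circ fusew k.
Proof. by apply: (wh_exchange (l := [::]) (m := [::]) (r := [::])); strands. Qed.

Lemma forkw_lft k x : wh [::] [:: s; s] x \circ forkw k = forkw k \circ lft 1 x.
Proof. by apply/esym/(wh_exchange (l := [::]) (m := [::]) (r := [::])); strands. Qed.

Lemma fusew_rung_forkw k :
  fusew k.+1 \circ wh [::] [:: s] (rungs C s t k.+2 k) \circ forkw k.+1 =
  one (Z k.+1 1) + capcup k.+1 1.
Proof.
have e1 : wh [::] [:: s] (rungs C s t k.+2 k) = wh (nseq k s) [::]
    (wh [::] [:: s] (ladder C s t) : Hom [:: s; s; s] [:: s; s; s])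
    :> Hom (nseq k.+3 s) (nseq k.+3 s).
  rewrite /rungs !wh_wh; try strands.
  by apply: wh_eq; strands.
have e2 : fusew k.+1 = wh (nseq k s) [::]
    (wh [:: s] [::] (fuse C s t) : Hom [:: s; s; s] [:: s; t]).
  by rewrite wh_wh; [apply: wh_eq|..]; strands.
have e3 : forkw k.+1 = wh (nseq k s) [::]
    (wh [:: s] [::] (fork C s t) : Hom [:: s; t] [:: s; s; s]).
  by rewrite wh_wh; [apply: wh_eq|..]; strands.
rewrite e1 e2 e3 -!wh_comp; try strands.
rewrite [X in wh _ _ X](_ : _ = corung C s t \circ rung C s t); last first.
  by rewrite /ladder wh_compE // !compA.
rewrite corung_rung // whD; congr (_ + _).
  by apply: wh_one; strands.
by apply: wh_comp; strands.
Qed.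

Lemma jw2_1 k : jw2 k 1 = lft 1 (jws k).
Proof. by rewrite jw2E -[jwt 1]/(one (nseq 1 t)) rgt_one comp1r. Qed.

Lemma clasp2_1 k : clasp2 k 1 = jw2 k 1 - (qint k / qint k.+2) *: turnback 1 k 1.
Proof.
rewrite /clasp2; case: k => [|k].
  by rewrite min0n big_ord1 coef0 expr0 mul1r scale1r qint0 mul0r scale0r subr0.
rewrite minnSS minn0 big_ord_recl big_ord1 /= coef0 expr0 mul1r scale1r.
congr (_ + _); rewrite expr1 mulN1r scaleNr; congr (- (_ *: _)).
have := coefS (leq0n (minn k 0)); rewrite coef0 qint1 // mul1r !subn0 mul1r mulr1.
by rewrite addn0 addn3 => <-; rewrite mulfK.
Qed.

Definition fusek k := fusew k \circ jwr k.
(** The factor is that of the recursion for [jws k.+2], so that [forkk] after [fusek] is the term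
    subtracted there. *)
Definition forkk k := (qint k.+1 / qint k.+2) *: (jwr k \circ forkw k).

Lemma jwr_idem k : jwr k \circ jwr k = jwr k.
Proof. by rewrite -wh_comp ?jw_idem //; strands. Qed.

(** Expanding [jwr] leaves a 2-gon and a 4-gon. The factor of [forkk] turns the coefficient [2] -
    [k]/[k+1] into 1 and [k]/[k+1] into [k]/[k+2], which are the coefficients of the clasp of s^k
    t. *)
Lemma fusek_forkk k : fusek k \circ forkk k = clasp2 k 1.
Proof.
have E : jwr k = wh [::] [:: s; s] (jws k) - (qint k / qint k.+1) *:
    (wh [::] [:: s; s] (jws k) \circ
      (wh [::] [:: s] (rungs C s t k.+1 k.-1) : Hom (nseq k.+2 s) (nseq k.+2 s))
      \circ wh [::] [:: s; s] (jws k)).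
  have e : wh [::] [:: s; s] (jws k) =
      wh [::] [:: s] (wh [::] [:: s] (jws k) : Hom (nseq k.+1 s) (nseq k.+1 s))
      :> Hom (nseq k.+2 s) (nseq k.+2 s).
    by rewrite wh_wh //; strands.
  rewrite e -!wh_comp; try strands.
  by rewrite -whZ -whB -jw_right.
have F : (qint k / qint k.+1) *: (fusew k \circ
    wh [::] [:: s] (rungs C s t k.+1 k.-1) \circ forkw k) =
    (qint k / qint k.+1) *: (one (Z k 1) + capcup k 1).
  case: k {E} => [|k]; first by rewrite qint0 !mul0r !scale0r.
  by rewrite fusew_rung_forkw.
rewrite /fusek /forkk compZr !compA -(compA _ (jwr k) (jwr k)) jwr_idem.
rewrite clasp2_1 turnback1 jw2_1 {}E !compE fusew_lft.
rewrite -!(compA _ (wh [::] [:: s; s] _) (forkw k)) forkw_lft !compA.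
rewrite -(compA _ (fusew k) (forkw k)) fusew_forkw.
move: F (lft_comp 1 (jws k) (jws k)); rewrite jw_idem //.
move: (lft 1 (jws k)) => p F pp.
have {}F : (qint k / qint k.+1) *: (p \circ fusew k \circ
    wh [::] [:: s] (rungs C s t k.+1 k.-1) \circ forkw k \circ p) =
    (qint k / qint k.+1) *: p + (qint k / qint k.+1) *: (p \circ capcup k 1 \circ p).
  rewrite -!(compA p) -compZr -compZl F compZl compZr compDl comp1l compDr -pp.
  by rewrite scalerDr compA.
rewrite F compZr comp1r opprD addrA -scalerBl scalerBr !scalerA.
congr (_ - _ *: _); last by field; rewrite !qint_neq0.
rewrite -[RHS]scale1r; congr (_ *: _).
by rewrite (qintSS qint_neq0 k); field; rewrite -(qintSS qint_neq0 k) !qint_neq0.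
Qed.

Lemma forkk_fusek k : jws k.+2 + forkk k \circ fusek k = jwr k.
Proof.
rewrite jw_right // -/(jwr k) /forkk /fusek compZl !compA -(compA (jwr k) (forkw k)).
by rewrite forkw_fusew subrK.
Qed.

Lemma clasp2_jw2 k l : jw2 k l \circ clasp2 k l = clasp2 k l /\
  clasp2 k l \circ jw2 k l = clasp2 k l.
Proof.
rewrite /clasp2 comp_sumr comp_suml; split; apply: eq_bigr => j _.
  by rewrite compZr jw2_turnback.
by rewrite compZl turnback_jw2.
Qed.

Lemma clasp2_0 k l : minn k l = 0 -> clasp2 k l = jw2 k l.
Proof. by move=> e; rewrite /clasp2 e big_ord1 coef0 expr0 mul1r scale1r. Qed.

Lemma clasp2_idem k l : clasp2 k l \circ clasp2 k l = clasp2 k l.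
Proof.
case: k => [|k]; first by rewrite clasp2_0 ?min0n ?jw2_idem.
case: l => [|l]; first by rewrite clasp2_0 ?minn0 ?jw2_idem.
(* The clasp is [jw2] minus [cupk] after [capk], and [capk] composed with either gives [capk]. *)
have cl0 : capk k l \circ clasp2 k.+1 l.+1 = 0.
  rewrite (canRL (addrK _) (cupk_capk k l)) compDr compNr compA capk_cupk.
  by rewrite -{1}capk_jw2 -compA jw2_idem {1}capk_jw2 // /capk compA capw_jw2 subrr.
rewrite {1}(canRL (addrK _) (cupk_capk k l)) compDl compNl -compA cl0 comp0r subr0.
by rewrite (clasp2_jw2 _ _).1.
Qed.

End TwoColours.

(* Composing [f] and [g] with [p - e] turns them into morphisms between the
   images of the idempotents.                                                 *)
Lemma retract (K : fieldType) (qhalf : K) (C : calculus qhalf) a b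
    (p e : Hom C a a) (p' : Hom C b b) (f : Hom C a b) (g : Hom C b a) :
  comp p p = p -> comp e e = e -> comp p e = e -> comp e p = e ->
  comp p' p' = p' -> comp f g = p' -> e + comp g f = p ->
  exists (f' : Hom C a b) (g' : Hom C b a),
    [/\ comp (comp p' f') p = f', comp (comp p g') p' = g', comp f' g' = p',
        comp e e + comp g' f' = p & comp f' e = 0 /\ comp e g' = 0].
Proof.
move=> pp ee pe ep p'p' fg egf.
have gfE : comp g f = p - e by rewrite -egf addrC addKr.
have pd : comp p (p - e) = p - e by rewrite compDr compNr pp pe.
have dp : comp (p - e) p = p - e by rewrite compDl compNl pp ep.
have de : comp (p - e) e = 0 by rewrite compDl compNl pe ee subrr.
have ed : comp e (p - e) = 0 by rewrite compDr compNr ep ee subrr.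
have dd : comp (p - e) (p - e) = p - e by rewrite compDr compNr dp de subr0.
exists (comp f (p - e)), (comp (p - e) g); split.
- by rewrite -fg -(compA f g) (compA g f) gfE dd -compA dp.
- by rewrite (compA p) pd -fg -compA (compA g) gfE (compA _ _ g) dd.
- by rewrite -compA (compA (p - e)) dd -gfE -(compA g) fg compA fg p'p'.
- by rewrite -compA (compA g) gfE !dd ee addrC subrK.
- by split; [rewrite -compA de comp0r | rewrite compA ed comp0l].
Qed.

(** From [E^2 = [3] E], the inverse of [1 + E] is [v = 1 - E / (1 + [3])]. The square relations for
    (s, t) and (t, s) give a left and a right inverse of the rung, which then coincide. *)
Lemma rung_iso (K : fieldType) (qhalf : K) (C : calculus qhalf) s t :
  (forall n, qint qhalf n.+1 != 0) -> t = ~~ s ->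
  exists g : Hom C [:: t; s] [:: s; t],
    comp g (rung C s t) = one C _ /\ comp (rung C s t) g = one C _.
Proof.
move=> q0 st; have ts : s = ~~ t by rewrite st negbK.
pose E s t := comp (cup C s t) (cap C s t).
pose v s t := one C [:: s; t] - (qint qhalf 2 * qint qhalf 2)^-1 *: E s t.
have EE s' t' : t' = ~~ s' -> comp (E s' t') (E s' t') = qint qhalf 3 *: E s' t'.
  move=> e; rewrite /E -compA (compA (cap C _ _)) cap_cup // compZl comp1l compZr.
  by [].
have q2 : qint qhalf 2 * qint qhalf 2 != 0 by rewrite mulf_neq0.
have vl s' t' : t' = ~~ s' -> comp (v s' t') (one C _ + E s' t') = one C _.
  move=> e; rewrite /v compDl compNl compZl comp1l compDr comp1r EE // qint3 //.
  rewrite -{2}[E s' t']scale1r -scalerDl addrCA subrr addr0 scalerA mulVf //.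
  by rewrite scale1r addrK.
have vr s' t' : t' = ~~ s' -> comp (one C _ + E s' t') (v s' t') = one C _.
  move=> e; rewrite /v compDr compNr compZr comp1r compDl comp1l EE // qint3 //.
  rewrite -{2}[E s' t']scale1r -scalerDl addrCA subrr addr0 scalerA mulVf //.
  by rewrite scale1r addrK.
have gl : comp (comp (v s t) (corung C s t)) (rung C s t) = one C _.
  by rewrite -compA corung_rung // vl.
have gr : comp (rung C s t) (comp (corung C s t) (v t s)) = one C _.
  by rewrite compA (rung_corung C st) -(rung_corung C ts) corung_rung // vr.
exists (comp (v s t) (corung C s t)); split=> //.
by rewrite -[in LHS](comp1r (comp (v s t) _)) -gr (compA _ (rung C s t)) gl comp1l.
Qed.

(** * The spider *)

Lemma Sp_lin_ext (K : fieldType) (qhalf : K) eps del (V : lmodType K)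
    (F G : {linear Sp qhalf eps del -> V}) :
  (forall D, F (web qhalf D) = G (web qhalf D)) -> F =1 G.
Proof.
move=> FG; elim/Sp_ind => [|c D f IH]; first by rewrite !linear0.
by rewrite !linearP IH FG.
Qed.

Section Whiskering.
Variables (K : fieldType) (qhalf : K).
Local Notation Sp := (Sp qhalf).
Local Notation web := (web qhalf).
Local Notation idm := (idm qhalf).

HB.instance Definition _ eps del eps' del' (f : Sp eps del) :=
  GRing.isLinear.Build K (Sp eps' del') (Sp (eps ++ eps') (del ++ del')) *:%R
    (@tensor K qhalf eps del eps' del' f) (tensorPr f).

(* The value is 0 if the words of signs do not match. *)
Definition whisk (l r : seq sign) a b a' b' (f : Sp a b) : Sp a' b' :=
  match l ++ a ++ r =P a', l ++ b ++ r =P b' with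
  | ReflectT ea, ReflectT eb =>
      ecast z (Sp z b') ea
        (ecast z (Sp (l ++ a ++ r) z) eb (idm l \ox (f \ox idm r)))
  | _, _ => 0
  end.
Arguments whisk l r {a b a' b'} f.

Lemma whiskE l r a b (f : Sp a b) :
  whisk l r f = idm l \ox (f \ox idm r) :> Sp (l ++ a ++ r) (l ++ b ++ r).
Proof.
rewrite /whisk; case: eqP => // ea; case: eqP => // eb.
by rewrite (eq_irrelevance ea erefl) (eq_irrelevance eb erefl).
Qed.

Lemma whisk_linear l r a b a' b' : linear (@whisk l r a b a' b').
Proof.
move=> c f g; rewrite /whisk.
case: eqP => [ea|_]; last by rewrite scaler0 addr0.
case: eqP => [eb|_]; last by rewrite scaler0 addr0.
by case: b' / eb; case: a' / ea => /=; rewrite tensorPl tensorPr.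
Qed.
HB.instance Definition _ l r a b a' b' :=
  GRing.isLinear.Build K (Sp a b) (Sp a' b') *:%R
    (@whisk l r a b a' b') (@whisk_linear l r a b a' b').

Lemma whisk_web l r a b a' b' (D : diagram a b) (D' : diagram a' b') :
  a' = l ++ a ++ r -> b' = l ++ b ++ r -> D' = whisker l r D :> seq slice ->
  whisk l r (web D) = web D'.
Proof.
move=> ea eb; move: D'; rewrite ea eb => D' eD.
rewrite whiskE !tensor_web; congr web; apply: val_inj => /=.
rewrite /= cats0 eD /whisker -map_comp.
by apply: eq_map => -[[l' g] r'] /=; rewrite cats0.
Qed.

Definition whisker_diagram l r a b (D : diagram a b) :=
  Diagram (is_diagram_whisker l r (diagramP D)).

Lemma whisk_webE l r a b (D : diagram a b) :
  whisk l r (web D) = web (whisker_diagram l r D).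
Proof. exact: whisk_web. Qed.

Lemma whisk_id l r a a' : a' = l ++ a ++ r -> whisk l r (idm a) = idm a'.
Proof. by move=> ->; apply: whisk_web. Qed.

Lemma whisk0 a b (f : Sp a b) : whisk [::] [::] f = f.
Proof.
move: f; apply: (Sp_lin_ext (G := idfun)) => D.
by apply: whisk_web; rewrite ?cats0 // whisker0.
Qed.

Lemma whisk_comp l r a b c a' b' c' (g : Sp b c) (f : Sp a b) :
  a' = l ++ a ++ r -> b' = l ++ b ++ r -> c' = l ++ c ++ r ->
  whisk l r (g \circ f) = (whisk l r g : Sp b' c') \circ (whisk l r f : Sp a' b').
Proof.
move=> -> -> ->; rewrite !whiskE.
by rewrite !tensor_compose !compose1l.
Qed.

Lemma whisk_compE l r a b c a' c' (g : Sp b c) (f : Sp a b) :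
  a' = l ++ a ++ r -> c' = l ++ c ++ r ->
  whisk l r (g \circ f) = (whisk l r g : Sp (l ++ b ++ r) c') \circ
    (whisk l r f : Sp a' (l ++ b ++ r)).
Proof. by move=> ea ec; apply: whisk_comp. Qed.

Lemma whisker_comp l r l' r' w :
  whisker l r (whisker l' r' w) = whisker (l ++ l') (r' ++ r) w.
Proof.
rewrite /whisker -map_comp; apply: eq_map => -[[l1 g] r1] /=.
by rewrite !catA.
Qed.

Lemma whisk_whisk l r l' r' a b a1 b1 a2 b2 (f : Sp a b) :
  a1 = l' ++ a ++ r' -> b1 = l' ++ b ++ r' ->
  a2 = l ++ a1 ++ r -> b2 = l ++ b1 ++ r ->
  whisk l r (whisk l' r' f : Sp a1 b1) = whisk (l ++ l') (r' ++ r) f :> Sp a2 b2.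
Proof.
move=> ea1 eb1 ea2 eb2; move: f.
apply: (Sp_lin_ext (F := (@whisk l r a1 b1 a2 b2) \o (@whisk l' r' a b a1 b1))).
move=> D /=; subst a1 b1; rewrite whisk_webE; subst a2 b2; rewrite whisk_webE.
apply/esym/whisk_web; rewrite ?catA //=.
by rewrite whisker_comp.
Qed.

Lemma whisk_exchange l m r l1 l2 r1 r2 a b c d x y z t
    (f : Sp a b) (g : Sp c d) :
  l1 = l ++ a ++ m -> l2 = l ++ b ++ m -> r1 = m ++ c ++ r -> r2 = m ++ d ++ r ->
  x = l ++ a ++ m ++ c ++ r -> y = l ++ b ++ m ++ c ++ r ->
  z = l ++ a ++ m ++ d ++ r -> t = l ++ b ++ m ++ d ++ r ->
  (whisk l2 r g : Sp y t) \circ (whisk l r1 f : Sp x y) =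
  (whisk l r2 f : Sp z t) \circ (whisk l1 r g : Sp x z).
Proof.
move=> -> -> -> -> -> -> -> ->.
(* Splitting the strands left of [g] exposes both webs as tensor factors, to which the interchange
   law applies. *)
have gE a1 : whisk (l ++ a1 ++ m) r g = idm l \ox (idm a1 \ox whisk m r g)
    :> Sp (l ++ a1 ++ m ++ c ++ r) (l ++ a1 ++ m ++ d ++ r).
  move: g; apply: (Sp_lin_ext (G := tensor (idm l) \o (tensor (idm a1) \o
    @whisk m r c d (m ++ c ++ r) (m ++ d ++ r)))) => E.
  rewrite /= whisk_webE !tensor_web; apply: whisk_web; rewrite -?catA //=.
  by rewrite !whisker_comp !cats0 ?catA.
by rewrite !gE !whiskE !tensor_compose !compose1l !compose1r.
Qed.

Lemma tensor_id0l a b (f : Sp a b) : idm [::] \ox f = f.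
Proof.
move: f; apply: (Sp_lin_ext (F := tensor (idm [::])) (G := idfun)) => D /=.
by rewrite tensor_web; congr web; apply: val_inj; rewrite /= whisker0.
Qed.

Lemma tensor_idl l a b (f : Sp a b) : idm l \ox f = whisk l [::] f.
Proof.
move: f; apply: (Sp_lin_ext (F := tensor (idm l))) => D.
by rewrite /= tensor_web; apply/esym/whisk_web; rewrite //= ?cats0.
Qed.

Lemma tensor_idr r a b (f : Sp a b) : f \ox idm r = whisk [::] r f.
Proof. by rewrite whiskE tensor_id0l. Qed.

Lemma tensorE a b c d (f : Sp a b) (g : Sp c d) :
  f \ox g = (whisk b [::] g : Sp (b ++ c) (b ++ d)) \circ
            (whisk [::] c f : Sp (a ++ c) (b ++ c)).
Proof. by rewrite -tensor_idl -tensor_idr tensor_compose compose1l compose1r. Qed.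
End Whiskering.
Arguments whisk {K qhalf} l r {a b a' b'} f.

(** * Webs given by lists of slices *)

Section Words.
Variables (K : fieldType) (qhalf : K).
Local Notation Sp := (Sp qhalf).
Local Notation web := (web qhalf).
Local Notation idm := (idm qhalf).

(** With no proof of well-formedness in the term, concrete webs are composed by concatenation, and
    well-formedness is a boolean computation. *)
Definition word a b (w : seq slice) : Sp a b :=
  if insub w is Some D then web D else 0.

Lemma wordE a b w (d : is_diagram a w b) : word a b w = web (Diagram d).
Proof. by rewrite /word insubT. Qed.

Lemma word_web a b (D : diagram a b) : word a b D = web D.
Proof. by rewrite (wordE (diagramP D)); congr web; apply: val_inj. Qed.

Lemma compose_word a b c w w' : is_diagram a w b -> is_diagram b w' c ->
  word b c w' \circ word a b w = word a c (w ++ w').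
Proof.
move=> d d'; rewrite (wordE d) (wordE d') compose_web -word_web.
by congr word.
Qed.

Lemma whisk_word l r a b a' b' w : is_diagram a w b ->
  a' = l ++ a ++ r -> b' = l ++ b ++ r ->
  whisk l r (word a b w) = word a' b' (whisker l r w).
Proof.
by move=> d -> ->; rewrite (wordE d) whisk_webE -word_web.
Qed.

Lemma word_move a b p u u' w w' : isotopy_move u u' ->
  w = plug p u -> w' = plug p u' -> is_diagram a w b -> is_diagram a w' b ->
  word a b w = word a b w'.
Proof.
move=> m e e' d d'; rewrite (wordE d) (wordE d').
apply: web_isotopic.
exact: (@isotopic_move _ _ p u u' (Diagram d) (Diagram d') m e e').
Qed.

(* The following are meant for [t = ~~ s]; keeping [t] free allows to exchange
   the roles of the two signs.                                                *)
Definition fuse_web s t : Sp [:: s; s] [:: t] := word _ _ (merge_slices s).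
Definition fork_web s t : Sp [:: t] [:: s; s] := word _ _ (split_slices s).
Definition cup_web s t : Sp [::] [:: s; t] := word _ _ [:: ([::], Cup s, [::])].
Definition cap_web s t : Sp [:: s; t] [::] := word _ _ [:: ([::], Cap s, [::])].
Definition vertex_web s : Sp [::] [:: s; s; s] := word _ _ [:: ([::], Vertex s, [::])].

Local Ltac words := rewrite /fork_web /fuse_web /cup_web /cap_web /vertex_web
  !(whisk_word, compose_word, whisk_compE) //=.

(** Rotating the vertex makes its right leg the end of a cup. With the cap this forms a zigzag,
    which straightens to a strand on the left once the cap has slid below the vertex. *)
Lemma fork_web_mirror s t : t = ~~ s ->
  fork_web s t = whisk [::] [:: s; s] (cap_web t s) \circ
    (whisk [:: t] [::] (vertex_web s) : Sp [:: t] [:: t; s; s; s]).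
Proof.
move->; case: s; words.
all: match goal with |- word [:: ?t] [:: ?s; _] _ = _ =>
apply: etrans (esym (word_move (p := Place [::] [::] [:: t] [:: ([:: s; s], Cap s, [::])])
   (w := [:: ([::], Cup t, [:: t]); ([:: t], Vertex s, [:: s; t]);
      ([::], Cap t, [:: s; s; s; t]); ([:: s; s], Cap s, [::])])
   (IsoRotate s) _ _ _ _)) _ => //;
apply: etrans (word_move (p := Place
      [:: ([::], Cup t, [:: t]); ([:: t], Vertex s, [:: s; t])] [::] [::] [::])
   (w' := [:: ([::], Cup t, [:: t]); ([:: t], Vertex s, [:: s; t]);
      ([:: t; s; s; s], Cap s, [::]); ([::], Cap t, [:: s; s])])
   (IsoExchange (Cap t) [:: s; s] (Cap s)) _ _ _ _) _ => //;
apply: etrans (word_move (p := Place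
      [:: ([::], Cup t, [:: t])] [:: t] [::] [:: ([::], Cap t, [:: s; s])])
   (w' := [:: ([::], Cup t, [:: t]); ([:: t], Cap s, [::]);
      ([:: t], Vertex s, [::]); ([::], Cap t, [:: s; s])])
   (IsoExchange (Vertex s) [::] (Cap s)) _ _ _ _) _ => //;
by apply: etrans (word_move (p := Place
      [::] [::] [::] [:: ([:: t], Vertex s, [::]); ([::], Cap t, [:: s; s])])
   (w' := [:: ([:: t], Vertex s, [::]); ([::], Cap t, [:: s; s])])
   (IsoZigzagL t) _ _ _ _) _
end.
Qed.

Lemma fuse_web_bend s t : t = ~~ s ->
  whisk [::] [:: t] (fuse_web s t) \circ
    (whisk [:: s] [::] (cup_web s t) : Sp [:: s] [:: s; s; t]) = fork_web t s.
Proof.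
move=> e; rewrite fork_web_mirror; last by rewrite e negbK.
move: e => ->; case: s; words.
all: match goal with |- word _ [:: ?t; _] _ = word [:: ?s] _ _ =>
by apply: etrans (word_move (p := Place [::] [:: s] [::] [:: ([::], Cap s, [:: t; t])])
   (IsoRotate t) _ _ _ _) _
end.
Qed.

Lemma fuse_web_bendl s t : t = ~~ s ->
  whisk [:: s] [::] (fuse_web t s) \circ
    (whisk [::] [:: t] (cup_web s t) : Sp [:: t] [:: s; t; t]) = fork_web s t.
Proof.
move=> e; rewrite fork_web_mirror //; move: e => ->; case: s; words.
all: match goal with |- word [:: ?t] [:: ?s; _] _ = _ =>
apply: etrans (word_move (p := Place [::] [::] [::]
      [:: ([:: s; t], Cap t, [:: s; s]); ([:: s], Cap t, [:: s])])
   (w' := [:: ([:: t], Vertex s, [::]); ([::], Cup s, [:: t; s; s; s]);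
      ([:: s; t], Cap t, [:: s; s]); ([:: s], Cap t, [:: s])])
   (IsoExchange (Cup s) [:: t] (Vertex s)) _ _ _ _) _ => //;
apply: etrans (word_move (p := Place [:: ([:: t], Vertex s, [::])] [::] [:: s; s]
      [:: ([:: s], Cap t, [:: s])])
   (w' := [:: ([:: t], Vertex s, [::]); ([::], Cap t, [:: s; s]);
      ([::], Cup s, [:: s; s]); ([:: s], Cap t, [:: s])])
   (IsoExchange (Cup s) [::] (Cap t)) _ _ _ _) _ => //;
by apply: etrans (word_move (p := Place [:: ([:: t], Vertex s, [::]);
      ([::], Cap t, [:: s; s])] [::] [:: s] [::])
   (w' := [:: ([:: t], Vertex s, [::]); ([::], Cap t, [:: s; s])])
   (IsoZigzagL s) _ _ _ _) _
end.
Qed.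

Lemma fork_web_bendl s t : t = ~~ s ->
  whisk [::] [:: t] (cap_web s t) \circ
    (whisk [:: s] [::] (fork_web t s) : Sp [:: s; s] [:: s; t; t]) = fuse_web s t.
Proof.
move=> e; rewrite fork_web_mirror; last by rewrite e negbK.
by move: e => ->; case: s; words.
Qed.

Lemma fork_web_bend s t : t = ~~ s ->
  whisk [:: s] [::] (cap_web s t) \circ
    (whisk [::] [:: t] (fork_web s t) : Sp [:: t; t] [:: s; s; t]) = fuse_web t s.
Proof.
move=> e; rewrite -fork_web_bendl; last by rewrite e negbK.
rewrite {1}fork_web_mirror //; move: e => ->; case: s; words.
all: match goal with |- word [:: ?t; _] [:: ?s] _ = _ =>
by apply: etrans (word_move (p := Place [:: ([:: t], Vertex s, [:: t])]
   [::] [::] [::]) (IsoExchange (Cap t) [:: s] (Cap s)) _ _ _ _) _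
end.
Qed.

Lemma fork_web_cup s t : t = ~~ s ->
  whisk [::] [:: s] (fork_web s t) \circ cup_web t s = vertex_web s.
Proof.
move->; case: s; words.
all: match goal with |- word _ [:: ?s; _; _] (_ :: (_, _, [:: ?t; _]) :: _) = _ =>
apply: etrans (esym (word_move (p := Place [::] [::] [::] [:: ([:: s; s], Cap s, [:: s])])
   (w := [:: ([::], Vertex s, [::]); ([:: s; s; s], Cup t, [::]);
      ([:: s; s], Cap s, [:: s])])
   (IsoExchange (Vertex s) [::] (Cup t)) _ _ _ _)) _ => //;
by apply: etrans (word_move (p := Place [:: ([::], Vertex s, [::])] [:: s; s] [::] [::])
   (w' := [:: ([::], Vertex s, [::])]) (IsoZigzagR s) _ _ _ _) _
end.
Qed.

Lemma fork_web_cupl s t : t = ~~ s ->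
  whisk [:: s] [::] (fork_web s t) \circ cup_web s t = vertex_web s.
Proof.
move=> e; rewrite fork_web_mirror //; move: e => ->; case: s; words.
all: match goal with |- word _ [:: ?s; _; _] (_ :: ([:: _; ?t], _, _) :: _) = _ =>
apply: etrans (word_move (p := Place [::] [::] [::] [:: ([:: s], Cap t, [:: s; s])])
   (w' := [:: ([::], Vertex s, [::]); ([::], Cup s, [:: s; s; s]);
      ([:: s], Cap t, [:: s; s])])
   (IsoExchange (Cup s) [::] (Vertex s)) _ _ _ _) _ => //;
by apply: etrans (word_move (p := Place [:: ([::], Vertex s, [::])] [::] [:: s; s] [::])
   (w' := [:: ([::], Vertex s, [::])]) (IsoZigzagL s) _ _ _ _) _
end.
Qed.
End Words.

Section Spider.
Variables (K : fieldType) (qhalf : K).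
Local Notation Sp := (Sp qhalf).
Local Notation idm := (idm qhalf).
Local Notation qint := (qint qhalf).
Local Notation fuse := (fuse_web qhalf).
Local Notation fork := (fork_web qhalf).
Local Notation cup := (cup_web qhalf).
Local Notation cap := (cap_web qhalf).
Local Notation word := (word qhalf).

Lemma cap_cup_web s t : t = ~~ s -> cap s t \circ cup s t = qint 3 *: idm [::].
Proof.
move->; rewrite compose_word; [|by case: s..].
have d : is_diagram [::] (loop_slices s) [::] by case: s.
rewrite (wordE _ d) -Sp_classZ; apply/Sp_class_eq.
by apply: (null_loop _ (p := Place [::] [::] [::] [::]) (s := s)); rewrite ?cats0.
Qed.

Lemma fuse_fork_web s t : t = ~~ s -> fuse s t \circ fork s t = qint 2 *: idm [:: t].
Proof.
move->; rewrite compose_word; [|by case: s..].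
have d : is_diagram [:: ~~ s] (bigon_slices s) [:: ~~ s] by case: s.
rewrite (wordE _ d) -Sp_classZ; apply/Sp_class_eq.
by apply: (null_bigon _ (p := Place [::] [::] [::] [::]) (s := s)).
Qed.

Lemma square_web s t : t = ~~ s ->
  whisk [:: s] [::] (fuse s t) \circ
    (whisk [::] [:: s] (fork s t) : Sp [:: t; s] [:: s; s; s]) \circ
    ((whisk [::] [:: s] (fuse s t) : Sp [:: s; s; s] [:: t; s]) \circ
      (whisk [:: s] [::] (fork s t) : Sp _ [:: s; s; s])) =
  idm [:: s; t] + cup s t \circ cap s t.
Proof.
move->; rewrite /fork_web /fuse_web /cup_web /cap_web.
rewrite !whisk_word ?compose_word; try by case: s.
have d : is_diagram [:: s; ~~ s] (square_slices s) [:: s; ~~ s] by case: (s).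
have d' : is_diagram [:: s; ~~ s] (capcup_slices s) [:: s; ~~ s] by case: (s).
rewrite [LHS](_ : _ = word [:: s; ~~ s] [:: s; ~~ s] (square_slices s)) //.
rewrite [X in _ + X](_ : _ = word [:: s; ~~ s] [:: s; ~~ s] (capcup_slices s)) //.
rewrite (wordE _ d) (wordE _ d') -Sp_classD; apply/Sp_class_eq.
by apply: (null_square _ (p := Place [::] [::] [::] [::]) (s := s));
  rewrite /plug ?whisker0 ?cats0 /=.
Qed.

Lemma fork_cup_web s t : t = ~~ s ->
  whisk [::] [:: s] (fork s t) \circ cup t s =
  whisk [:: s] [::] (fork s t) \circ cup s t :> Sp [::] [:: s; s; s].
Proof. by move=> e; rewrite fork_web_cup // fork_web_cupl. Qed.

Definition spider : calculus qhalf := @Calculus K qhalf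
  (fun a b => Sp a b) (fun a b c g f => g \circ f) idm
  (fun a b c d k g f => composeA k g f) (@compose1l K qhalf) (@compose1r K qhalf)
  (fun a b c f x g g' => composePl f x g g') (fun a b c g x f f' => composePr g x f f')
  (fun l r a b a' b' f => whisk l r f) (@whisk_linear K qhalf) (@whisk_id K qhalf)
  (@whisk0 K qhalf) (@whisk_comp K qhalf) (@whisk_whisk K qhalf)
  (@whisk_exchange K qhalf) fuse fork cup cap cap_cup_web fuse_fork_web square_web
  (@fuse_web_bend K qhalf) (@fuse_web_bendl K qhalf) (@fork_web_bend K qhalf)
  (@fork_web_bendl K qhalf) fork_cup_web.
End Spider.

(** * The clasps of the spider in the calculus *)

Section SpiderClasps.
Variables (K : fieldType) (qhalf : K).
Local Notation Sp := (Sp qhalf).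
Local Notation idm := (idm qhalf).
Local Notation C := (spider qhalf).
Hypothesis qint_neq0 : forall n, qint qhalf n.+1 != 0.

Lemma cast_endE a b (e : a = b) (f : Sp a a) : cast_end e f = whisk [::] [::] f.
Proof. by case: b / e; rewrite whisk0. Qed.

Lemma clasp1S s k : clasp1 qhalf s k.+1 = clasp_step (clasp1 qhalf s k).
Proof. by []. Qed.

Lemma clasp1E s t k : t = ~~ s -> clasp1 qhalf s k = jw C s t k.
Proof.
move=> ->; elim: k => [|[|k] IHk]; [reflexivity|reflexivity|].
rewrite clasp1S (jw_right C (erefl (~~ s))) -IHk [clasp_step _]/clasp_step.
rewrite !cast_endE tensor_idr tensor_idl !whisk_whisk; try strands.
have -> : web qhalf (split_diagram s) \circ web qhalf (merge_diagram s) =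
    ladder C s (~~ s).
  by rewrite -!word_web.
rewrite /rungs subnn cats0; reflexivity.
Qed.

Lemma clasp1_tensor s t k l : t = ~~ s ->
  clasp1 qhalf s k \ox clasp1 qhalf t l = jw2 C s t k l.
Proof.
move=> st; have ts : s = ~~ t by rewrite st negbK.
rewrite tensorE (clasp1E _ st) (clasp1E _ ts) jw2E -lft_rgt; reflexivity.
Qed.

Lemma nseq_pair k l :
  nseq k true ++ [:: true; false] ++ nseq l false = posneg k.+1 l.+1.
Proof. by rewrite /posneg; strands. Qed.

(** The innermost turnback has the lowest cap and the highest cup: it gives the first and the last
    slice. *)
Lemma nestedE j k l : (j <= minn k l)%N ->
  nested C true false j k l = word qhalf (posneg k l) (posneg k l)
    (whisker (nseq (k - j) true) (nseq (l - j) false) (caps_slices j ++ cups_slices j)).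
Proof.
elim: j k l => [|j IHj] k l le_j.
  by rewrite (wordE qhalf (eqxx _ : is_diagram (posneg k l) [::] (posneg k l))).
case: k l le_j => [|k] [|l]; rewrite ?minn0 ?min0n ?minnSS ?ltn0 // ltnS => le_j.
have capE : capw C true false k l = word qhalf (posneg k.+1 l.+1) (posneg k l)
    [:: (nseq k true, Cap true, nseq l false)].
  apply: etrans (whisk_word _ _ _ _) _ => //; rewrite /posneg; try strands.
  by rewrite /= cats0.
have cupE : cupw C true false k l = word qhalf (posneg k l) (posneg k.+1 l.+1)
    [:: (nseq k true, Cup true, nseq l false)].
  apply: etrans (whisk_word _ _ _ _) _ => //; rewrite /posneg; try strands.
  by rewrite /= cats0.
have capD : is_diagram (posneg k.+1 l.+1) [:: (nseq k true, Cap true, nseq l false)]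
    (posneg k l).
  by rewrite /= nseq_pair !eqxx.
have cupD : is_diagram (posneg k l) [:: (nseq k true, Cup true, nseq l false)]
    (posneg k.+1 l.+1).
  by rewrite /= nseq_pair !eqxx.
have midD : is_diagram (posneg k l) (whisker (nseq (k - j) true) (nseq (l - j) false)
    (caps_slices j ++ cups_slices j)) (posneg k l).
  have := is_diagram_whisker (nseq (k - j) true) (nseq (l - j) false)
    (is_diagram_cat (caps_subproof j) (cups_subproof j)).
  by rewrite (_ : _ ++ (_ ++ _) ++ _ = posneg k l) // /posneg; strands.
transitivity (cupw C true false k l \circ nested C true false j k l
                \circ capw C true false k l); first reflexivity.
rewrite capE cupE IHj // (compose_word _ midD cupD).
rewrite (compose_word _ capD (is_diagram_cat midD cupD)) /caps_slices /cups_slices.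
congr word; rewrite -[in RHS](addn1 j) iotaD !map_cat rev_cat /whisker !map_cat.
have [ej ek el] : [/\ (k.+1 - (j + 1) = k - j)%N, (k - j + j = k)%N
    & (j + (l - j) = l)%N /\ (l.+1 - (j + 1) = l - j)%N] by split; lia.
by rewrite /= ej el.2 add0n -!nseqD ek el.1 -!catA.
Qed.

Lemma claspE k l : clasp qhalf k l = clasp2 C true false k l.
Proof.
rewrite /clasp (clasp1_tensor k l (erefl (~~ true))) /clasp2; apply: eq_bigr => i _.
have le_i : (i <= minn k l)%N by rewrite -ltnS.
rewrite (turnbackE C qint_neq0 (erefl (~~ true)) le_i); congr (_ *: (_ \circ _ \circ _)).
rewrite (nestedE le_i) /cupcap cast_endE tensor_idl tensor_idr -!word_web.
rewrite compose_word; [|exact: diagramP|exact: diagramP].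
have d : is_diagram (nseq i true ++ nseq i false) (caps_slices i ++ cups_slices i)
    (nseq i true ++ nseq i false).
  exact: is_diagram_cat (caps_subproof i) (cups_subproof i).
rewrite whisk_whisk; try strands.
rewrite whisk_whisk; rewrite ?(posneg_split i) //; try strands.
rewrite whisk_word ?cats0 ?(posneg_split i) //; reflexivity.
Qed.
End SpiderClasps.

(** * The Grothendieck ring *)

Section GrothendieckClasses.
Variables (K : fieldType) (qhalf : K).
Local Notation Sp := (Sp qhalf).
Local Notation idm := (idm qhalf).
Local Notation cl := (@K0_class K qhalf).

Lemma kar_imageE Z (f : Sp Z Z) (ff : f \circ f = f) : kar_image f = KarObj ff.
Proof.
rewrite /kar_image; case: pselect => [ff'|/(_ ff)[]].
by rewrite (Prop_irrelevance ff' ff).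
Qed.

Lemma K0_class_tensor A B : cl (kar_tensor A B) = cl A * cl B.
Proof.
rewrite -[RHS]/(pr_mul (cl A) (cl B)) pr_mulE.
by apply/ring_class_eq/rc_rel; exact: (K0_tensor [:: A] [:: B]).
Qed.

Lemma K0_class_one : cl (kar_of qhalf [::]) = 1.
Proof. by apply/ring_class_eq/rc_rel; exact: K0_unit. Qed.

Lemma kar_image_tensor Z W (f : Sp Z Z) (g : Sp W W) :
  f \circ f = f -> g \circ g = g ->
  cl (kar_image (f \ox g)) = cl (kar_image f) * cl (kar_image g).
Proof.
move=> ff gg; rewrite -K0_class_tensor (kar_imageE ff) (kar_imageE gg).
have fg : (f \ox g) \circ (f \ox g) = f \ox g by rewrite tensor_compose ff gg.
rewrite (kar_imageE fg); congr (cl (KarObj _)); exact: Prop_irrelevance.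
Qed.

Lemma kar_image_cast Z W (e : Z = W) (f : Sp Z Z) :
  cl (kar_image (whisk [::] [::] f : Sp W W)) = cl (kar_image f).
Proof. by case: W / e; rewrite whisk0. Qed.

Lemma K0_class_sum A B C
    (pB : Sp (kar_dom A) (kar_dom B)) (iB : Sp (kar_dom B) (kar_dom A))
    (pC : Sp (kar_dom A) (kar_dom C)) (iC : Sp (kar_dom C) (kar_dom A)) :
  is_kar_hom pB -> is_kar_hom iB -> is_kar_hom pC -> is_kar_hom iC ->
  pB \circ iB = kar_idem B -> pC \circ iC = kar_idem C ->
  pB \circ iC = 0 -> pC \circ iB = 0 ->
  iB \circ pB + iC \circ pC = kar_idem A ->
  cl A = cl B + cl C.
Proof.
move=> hpB hiB hpC hiC eB eC eBC eCB eA.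
rewrite -[RHS]/(pr_add (cl B) (cl C)) pr_addE.
apply/ring_class_eq; apply: rc_trans (rc_rel (K0_sum [:: B] [:: C])).
apply/rc_rel/K0_iso.
(* The type of an entry depends on its indices, so the entries are chosen by matching on the values
   of the ordinals; the bounds exclude the default branch. *)
pose phi : @add_mx K qhalf [:: A] [:: B; C] := fun i j =>
  match i, j with
  | @Ordinal _ m hm, @Ordinal _ n hn =>
    match m, n return forall (hm : (m < 1)%N) (hn : (n < 2)%N),
       Sp (kar_dom (@summand K qhalf [:: A] (Ordinal hm)))
          (kar_dom (@summand K qhalf [:: B; C] (Ordinal hn))) with
    | 0, 0 => fun _ _ => pB
    | 0, 1 => fun _ _ => pC
    | _, _ => fun _ _ => 0
    end hm hn
  end.
pose psi : @add_mx K qhalf [:: B; C] [:: A] := fun j i =>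
  match j, i with
  | @Ordinal _ n hn, @Ordinal _ m hm =>
    match n, m return forall (hn : (n < 2)%N) (hm : (m < 1)%N),
       Sp (kar_dom (@summand K qhalf [:: B; C] (Ordinal hn)))
          (kar_dom (@summand K qhalf [:: A] (Ordinal hm))) with
    | 0, 0 => fun _ _ => iB
    | 1, 0 => fun _ _ => iC
    | _, _ => fun _ _ => 0
    end hn hm
  end.
exists phi, psi; split.
- by move=> [[|//] hm] [[|[|//]] hn].
- by move=> [[|[|//]] hn] [[|//] hm].
- split=> [[[|//] hm]|[[|//] hm] [[|//] hn] //].
  rewrite /add_comp [LHS](_ : _ = \sum_(j < 2)
    (psi j (Ordinal hm) \circ phi (Ordinal hm) j)) // !big_ord_recl big_ord0 addr0.
  exact: eA.
- split=> [[[|[|//]] hn]|[[|[|//]] hn] [[|[|//]] hm] //] => [||_|_].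
  all: rewrite /add_comp; rewrite big_ord1.
  all: by [exact: eB|exact: eC|exact: eCB|exact: eBC].
Qed.
End GrothendieckClasses.

(** * Classes of clasps *)

Section Relations.
Variables (K : fieldType) (qhalf : K).
Local Notation Sp := (Sp qhalf).
Local Notation idm := (idm qhalf).
Local Notation cl := (@K0_class K qhalf).
Local Notation C := (spider qhalf).

(** The zero object [Z] is the sum of two copies of itself, so its class is 0, and an isomorphism is
    a splitting of [A] into [B] and [Z]. *)
Lemma K0_class_iso A B (f : Sp (kar_dom A) (kar_dom B)) (g : Sp (kar_dom B) (kar_dom A)) :
  is_kar_hom f -> is_kar_hom g -> f \circ g = kar_idem B -> g \circ f = kar_idem A ->
  cl A = cl B.
Proof.
move=> hf hg fg gf.
pose Z := KarObj (compose0l (0 : Sp [::] [::])).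
have h0 D : @is_kar_hom K qhalf D Z 0 /\ @is_kar_hom K qhalf Z D 0.
  by rewrite /is_kar_hom !compose0r !compose0l.
have Z0 : cl Z = 0.
  apply: (addrI (cl Z)); rewrite addr0; apply/esym.
  apply: (@K0_class_sum _ _ Z Z Z 0 0 0 0); try exact: (h0 Z).1.
  1-4: exact: compose0l.
  by rewrite compose0l addr0.
rewrite -[RHS]addr0 -Z0.
apply: (@K0_class_sum _ _ A B Z f g 0 0); try assumption.
- exact: (h0 A).1.
- exact: (h0 A).2.
- exact: compose0l.
- exact: compose0r.
- exact: compose0l.
- by rewrite compose0l gf addr0.
Qed.

Lemma K0_class_retract a b (p e : Sp a a) (p' : Sp b b) (f : Sp a b) (g : Sp b a) :
  p \circ p = p -> e \circ e = e -> p \circ e = e -> e \circ p = e ->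
  p' \circ p' = p' -> f \circ g = p' -> e + g \circ f = p ->
  cl (kar_image p) = cl (kar_image e) + cl (kar_image p').
Proof.
move=> pp ee pe ep p'p' fg egf.
have [f' [g' [hf' hg' fg' egf' [fe eg]]]] :=
  @retract K qhalf C a b p e p' f g pp ee pe ep p'p' fg egf.
rewrite (kar_imageE pp) (kar_imageE ee) (kar_imageE p'p').
apply: (@K0_class_sum _ _ (KarObj pp) (KarObj ee) (KarObj p'p') e e f' g').
- by rewrite /is_kar_hom /= ee ep.
- by rewrite /is_kar_hom /= pe ee.
- exact: hf'.
- exact: hg'.
- exact: ee.
- exact: fg'.
- exact: eg.
- exact: fe.
- exact: egf'.
Qed.

Hypothesis qint_neq0 : forall n, qint qhalf n.+1 != 0.

Definition clasp_class s k := cl (kar_image (clasp1 qhalf s k)).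

Lemma clasp1_idem s k : clasp1 qhalf s k \circ clasp1 qhalf s k = clasp1 qhalf s k.
Proof.
rewrite (clasp1E qhalf k (erefl (~~ s))).
exact: (jw_idem C qint_neq0 (erefl (~~ s)) k).
Qed.

Lemma clasp_class0 s : clasp_class s 0 = 1.
Proof.
rewrite -(K0_class_one qhalf) /clasp_class (kar_imageE (clasp1_idem s 0)).
congr (cl (KarObj _)); exact: Prop_irrelevance.
Qed.

Lemma clasp_class1 s : clasp_class s 1 = cl (kar_of qhalf [:: s]).
Proof.
rewrite /clasp_class (kar_imageE (clasp1_idem s 1)).
congr (cl (KarObj _)); exact: Prop_irrelevance.
Qed.

Lemma clasp_classM s t k l : t = ~~ s ->
  clasp_class s k * clasp_class t l = cl (kar_image (jw2 C s t k l)).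
Proof.
move=> st; rewrite -(clasp1_tensor qhalf k l st).
by rewrite kar_image_tensor //; exact: clasp1_idem.
Qed.

Lemma clasp_class_split s t k l : t = ~~ s ->
  clasp_class s k.+1 * clasp_class t l.+1 =
  cl (kar_image (clasp2 C s t k.+1 l.+1)) + clasp_class s k * clasp_class t l.
Proof.
move=> st; rewrite !clasp_classM //.
apply: K0_class_retract.
- exact: (jw2_idem C qint_neq0 st).
- exact: (clasp2_idem C qint_neq0 st).
- exact: (clasp2_jw2 C qint_neq0 st _ _).1.
- exact: (clasp2_jw2 C qint_neq0 st _ _).2.
- exact: (jw2_idem C qint_neq0 st).
- exact: (capk_cupk C qint_neq0 st).
- exact: (cupk_capk C qint_neq0).
Qed.

Lemma clasp_class_mul_sign s t k : t = ~~ s ->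
  clasp_class s k.+1 * clasp_class s 1 =
  clasp_class s k.+2 + cl (kar_image (clasp2 C s t k 1)).
Proof.
move=> st; rewrite -kar_image_tensor; try exact: clasp1_idem.
have e : nseq k.+1 s ++ nseq 1 s = nseq k.+2 s by strands.
rewrite -(kar_image_cast e) -[clasp1 qhalf s 1]/(idm [:: s]) tensor_idr.
rewrite whisk_whisk; try strands.
rewrite cats0 /clasp_class !(clasp1E qhalf _ st).
apply: (@K0_class_retract _ _ (jwr C s t k)).
- exact: (jwr_idem C qint_neq0 st).
- exact: (jw_idem C qint_neq0 st).
- exact: (jw_absorb_right C qint_neq0 st _).1.
- exact: (jw_absorb_right C qint_neq0 st _).2.
- exact: (clasp2_idem C qint_neq0 st).
- exact: (fusek_forkk C qint_neq0 st).
- exact: (forkk_fusek C st).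
Qed.

Lemma idm_tensor a b : idm a \ox idm b = idm (a ++ b).
Proof. by rewrite tensor_idl; apply: whisk_id; rewrite cats0. Qed.

Lemma clasp_class1C s t : t = ~~ s ->
  clasp_class s 1 * clasp_class t 1 = clasp_class t 1 * clasp_class s 1.
Proof.
move=> st; have [g [gl gr]] := rung_iso C qint_neq0 st.
rewrite !clasp_class1 -!K0_class_tensor.
have hom a b (f : Sp (a ++ b) (b ++ a)) :
    @is_kar_hom K qhalf (kar_tensor (kar_of qhalf a) (kar_of qhalf b))
      (kar_tensor (kar_of qhalf b) (kar_of qhalf a)) f.
  by rewrite /is_kar_hom /= !idm_tensor compose1l compose1r.
apply: (@K0_class_iso (kar_tensor (kar_of qhalf [:: s]) (kar_of qhalf [:: t]))
  (kar_tensor (kar_of qhalf [:: t]) (kar_of qhalf [:: s])) (rung C s t) g).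
- exact: hom.
- exact: hom.
- rewrite /= idm_tensor; exact: gr.
- rewrite /= idm_tensor; exact: gl.
Qed.

(** The convention S_(-1) = T_(-1) = 0 keeps the formulas uniform at the boundary. *)
Definition clasp_pred s k := if k is k'.+1 then clasp_class s k' else 0.

Lemma clasp_class_clasp2 s t k l : t = ~~ s ->
  cl (kar_image (clasp2 C s t k l)) =
  clasp_class s k * clasp_class t l - clasp_pred s k * clasp_pred t l.
Proof.
move=> st; case: k => [|k]; last case: l => [|l].
- by rewrite mul0r subr0 (clasp_classM _ _ st) clasp2_0 // min0n.
- by rewrite mulr0 subr0 (clasp_classM _ _ st) clasp2_0 // minn0.
- by rewrite (clasp_class_split _ _ st) addrK.
Qed.

(** Eliminates the class of the clasp of s^k t between the two product formulas. For s = + it is the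
    recursion of the complete symmetric functions in three variables whose elementary ones are X,
    T_1 and 1. *)
Lemma clasp_class_rec s t k : t = ~~ s -> clasp_class s k.+2 =
  clasp_class s k.+1 * clasp_class s 1 - clasp_class s k * clasp_class t 1
    + clasp_pred s k.
Proof.
move=> st; rewrite (clasp_class_mul_sign _ st) (clasp_class_clasp2 _ _ st).
rewrite [clasp_pred t 1](clasp_class0 t) mulr1.
by rewrite -addrA [- _ + _]addrC -[X in _ = _ + X]opprB addrK.
Qed.
End Relations.

(** * Algebra of the fusion rule *)

Section FusionRing.
Variables (R : pzRingType) (x y : nat -> R).
Let pred (z : nat -> R) k := if k is k'.+1 then z k' else 0.
Hypotheses (x0 : x 0 = 1) (y0 : y 0 = 1) (xy : x 1 * y 1 = y 1 * x 1).
Hypothesis x_rec : forall k, x k.+2 = x k.+1 * x 1 - x k * y 1 + pred x k.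
Hypothesis y_rec : forall k, y k.+2 = y k.+1 * y 1 - y k * x 1 + pred y k.

(** The recursion reaches three steps back, so the induction carries three consecutive terms. *)
Lemma comm_rec (z : R) (u v : nat -> R) : u 0 = 1 ->
  (forall k, u k.+2 = u k.+1 * u 1 - u k * v 1 + pred u k) ->
  GRing.comm z (u 1) -> GRing.comm z (v 1) -> forall k, GRing.comm z (u k).
Proof.
move=> u0 u_rec zu zv k.
suff: GRing.comm z (pred u k) /\ GRing.comm z (u k) /\ GRing.comm z (u k.+1).
  by case=> _ [].
elim: k => [|k [zp [zk zk1]]].
  by split; [exact: commr0 | rewrite u0; split=> //; exact: commr1].
split=> //; split=> //; rewrite u_rec.
by apply: commrD => //; apply: commrB; apply: commrM.
Qed.

Lemma fusion_rule k l :
  x k.+2 * y l.+1 - x k.+1 * y l =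
  x 1 * (x k.+1 * y l.+1 - x k * y l) - (x k * y l.+2 - pred x k * y l.+1)
    - (x k.+1 * y l - x k * pred y l).
Proof.
have xx m : x 1 * x m = x m * x 1 by apply: (comm_rec (v := y)).
have xyl m : x 1 * y m = y m * x 1 by apply: (comm_rec (v := x)).
have yy m : y 1 * y m = y m * y 1 by apply: (comm_rec (v := x)).
(* Only [x k.+2] and [y l.+2] are expanded; with [x 1] and [y 1] moved to the right, the two sides
   have the same monomials. *)
rewrite x_rec y_rec !(mulrDr, mulrDl, mulrN, mulNr).
rewrite !mulrA !xx -(mulrA (x k) (y 1)) yy -(mulrA (x k) (x 1)) xyl !mulrA.
move: (x k.+1 * x 1 * y l.+1) (x k * y l.+1 * y 1) (pred x k * y l.+1).
move: (x k.+1 * y l) (x k * y l * x 1) (x k * pred y l).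
move=> d e f a b c; rewrite !opprD !opprK !addrA.
by rewrite (addrAC _ (- b) e) subrK (addrAC _ (- d) f) (addrAC _ c f) subrK.
Qed.
End FusionRing.

(** * Quantum integers in C(q^(1/6)) *)

Lemma qint_neq0_transc (K : fieldType) (h : K) n :
  h != 0 -> (forall m, h ^+ m.+1 != 1) -> qint h n.+1 != 0.
Proof.
move=> h0 h1; have hn m : h ^+ m.+1 - h ^- m.+1 != 0.
  (* If h^n = h^(-n) with n = m + 1, then h^(2n) = 1. *)
  apply: contraNneq (h1 (m + m.+1)%N) => /subr0_eq e.
  by rewrite -addSn exprD {1}e mulVf // expf_neq0.
by rewrite /qint mulf_neq0 ?hn // invr_eq0; have := hn 0; rewrite expr1.
Qed.

Lemma Cq_qint_neq0 (R : realType) n : qint (Cq_qhalf R) n.+1 != 0.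
Proof.
apply: qint_neq0_transc => [|m].
  by rewrite /Cq_qhalf tofrac_eq0 -size_poly_eq0 size_polyXn.
rewrite /Cq_qhalf -tofracXn -tofrac1 tofrac_eq -exprM.
by apply/eqP => /(congr1 (fun p : {poly R[i]} => size p)); rewrite size_polyXn size_poly1.
Qed.

Theorem proposition3p14 (R : realType) (k l : nat)
    (k_ge1 : (1 <= k)%N) (l_ge1 : (1 <= l)%N) :
  let X := K0_class (kar_of (Cq_qhalf R) [:: true]) in
  K0_class (clasp_obj R k.+1 l) =
    X * K0_class (clasp_obj R k l)
      - K0_class (clasp_obj R k.-1 l.+1) - K0_class (clasp_obj R k l.-1).
Proof.
case: k l k_ge1 l_ge1 => [|k] [|l] // _ _ X.
have q0 := Cq_qint_neq0 R.
have cE m n : K0_class (clasp_obj R m n) =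
    clasp_class (Cq_qhalf R) true m * clasp_class (Cq_qhalf R) false n -
    clasp_pred (Cq_qhalf R) true m * clasp_pred (Cq_qhalf R) false n.
  by rewrite /clasp_obj (claspE q0) (clasp_class_clasp2 q0 _ _ (erefl (~~ true))).
rewrite !cE /X -(clasp_class1 q0).
apply: fusion_rule.
- exact: (clasp_class0 q0).
- exact: (clasp_class0 q0).
- exact: (clasp_class1C q0).
- by move=> m; apply: (clasp_class_rec q0).
- by move=> m; apply: (clasp_class_rec q0).
Qed.
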